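(* Let $S\subset\mathbb{R}^d$ be nonempty and closed. Suppose that $X^1,X^2,\dots$ are iid random vectors with values in $S^0\subset\mathbb{R}^{d_0}$, $F$ is a closed subset of $(\mathrm{usc\text{-}fcns}(S),\mathbf{d})$, $\psi:S^0\times F\to[-\infty,\infty]$ is a locally inf-integrable random lsc function (with respect to the distribution of $X^1$), and $\pi^n:F\to[0,\infty)$, $n\in\mathbb{N}$, satisfies $\pi^n(f^n)\to0$ for every convergent sequence $\{f^n\in F, n\in\mathbb{N}\}$. Then the following hold almost surely: (i) For all sequences $\{\epsilon^n\geq0,n\in\mathbb{N}\}\to0$, $$\operatorname{OutLim}\Big(\epsilon^n\text{-}\operatorname{argmin}_{f\in F}\ \frac1n\sum_{j=1}^n\psi(X^j,f)+\pi^n(f)\Big)\subset\operatorname{argmin}_{f\in F}\ \mathbb{E}[\psi(X^1,f)].$$ (ii) There exists $\{\epsilon^n\geq0,n\in\mathbb{N}\}\to0$ such that $$\Big(\epsilon^n\text{-}\operatorname{argmin}_{f\in F}\ \frac1n\sum_{j=1}^n\psi(X^j,f)+\pi^n(f)\Big)\ \text{set-converges to}\ \operatorname{argmin}_{f\in F}\ \mathbb{E}[\psi(X^1,f)],$$ provided that $\mathbb{E}[\psi(X^1,f)]<\infty$ for at least one $f\in F$ and $F$ is bounded.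
   Context: Notation: $\overline{\mathbb{R}}=[-\infty,\infty]$. $\mathrm{usc\text{-}fcns}(S)$ is the set of upper semicontinuous (usc) functions $f:S\to\overline{\mathbb{R}}$ with $f\not\equiv-\infty$. The hypograph is $\operatorname{hypo} f=\{(x,\alpha)\in S\times\mathbb{R}\mid f(x)\geq\alpha\}$. Fix any norm on $\mathbb{R}^d\times\mathbb{R}$ and a point $z^{\rm ctr}\in S\times\mathbb{R}$. The Attouch-Wets (aw) distance is $\mathbf{d}(f,g)=\int_0^\infty \mathbf{d}_\rho(f,g)e^{-\rho}d\rho$, where $\mathbf{d}_\rho(f,g)=\max\{|\operatorname{dist}(z,\operatorname{hypo} f)-\operatorname{dist}(z,\operatorname{hypo} g)| : \|z-z^{\rm ctr}\|\leq\rho\}$ and $\operatorname{dist}$ is the point-to-set distance. Convergence, closedness, boundedness in $\mathrm{usc\text{-}fcns}(S)$ are with respect to $\mathbf{d}$. Convergence $\mathbf{d}(f^n,f)\to0$ is equivalent to hypo-convergence: $\limsup f^n(x^n)\leq f(x)$ for all $x^n\in S\to x$, and for every $x\in S$ there is $x^n\in S\to x$ with $\liminf f^n(x^n)\geq f(x)$. For $\phi:F\to\overline{\mathbb{R}}$ and $\epsilon\geq0$, $\epsilon\text{-}\operatorname{argmin}_{f\in F}\phi(f)=\{f\in F\mid\phi(f)\leq\inf_{g\in F}\phi(g)+\epsilon\}$, and $\operatorname{argmin}$ is the case $\epsilon=0$. $\phi$ is lsc if $\liminf\phi(f^n)\geq\phi(f)$ whenever $f^n\in F\to f\in F$. Set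 limits: for sets $A^n$ in a topological space, $\operatorname{OutLim}A^n$ is the collection of points to which a subsequence of some sequence $\{a^n\in A^n\}$ converges; $\operatorname{InnLim}A^n$ is the collection of points to which some sequence $\{a^n\in A^n\}$ converges. If both equal $A$, then $A^n$ set-converges to $A$. Here the space is $(\mathrm{usc\text{-}fcns}(S),\mathbf{d})$. Extended arithmetic: $0\cdot\infty=0$, $\alpha\cdot\infty=\infty$ for $\alpha>0$, $\alpha+\infty=\infty$ for $\alpha\in\overline{\mathbb{R}}$, $\alpha-\infty=-\infty$ for $\alpha\in[-\infty,\infty)$; in particular $\infty-\infty=\infty$, so the integral of any measurable extended real-valued function is well defined. Let $(S^0,\mathcal{B}^0,P^0)$ be a complete probability space with $P^0$ the distribution of $X^1$. $\psi:S^0\times F\to\overline{\mathbb{R}}$ is a random lsc function if $\psi(x,\cdot)$ is lsc for all $x\in S^0$ and $\psi$ is measurable with respect to the product sigma-algebra on $S^0\times F$ (with the Borel sigma-algebra under $\mathbf{d}$ on $F$). It is locally inf-integrable if for all $f\in F$ there exists $\rho>0$ such that $\int\inf_{g\in F}\{\psi(x,g)\mid\mathbf{d}(f,g)\leq\rho\}\,dP^0(x)>-\infty$.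
   Formalization: Locally inf-integrable is read as: the negative part of the infimum of ψ(x,·) over the ball is integrable. With the convention ∞−∞=∞ the condition would also admit infima whose positive and negative parts both have infinite integral, and then (i) can fail. *)

(* Defs.v *)
From HB Require Import structures.
From mathcomp Require Import all_boot all_order all_algebra.
From mathcomp Require Import all_classical all_reals all_analysis measurable_realfun.
Import Order.TTheory GRing.Theory Num.Theory.
Import numFieldNormedType.Exports.

Set Implicit Arguments.
Unset Strict Implicit.
Unset Printing Implicit Defensive.

Local Open Scope classical_set_scope.
Local Open Scope ring_scope.

(* [T] with the distinguished point [x0]: [measurableType]s are pointed, a
   subtype [set_type A] is not. *)
Definition based {T : choiceType} (x0 : T) : Type := T.
HB.instance Definition _ (T : choiceType) (x0 : T) := Choice.on (based x0).
HB.instance Definition _ (T : choiceType) (x0 : T) :=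
  isPointed.Build (based x0) x0.

(* The measurable space (S0, B0), for B0 a sigma-algebra on the set S0. *)
Definition sample_space {T : choiceType} {S0 : set T} (x0 : S0)
  (B0 : set (set S0)) := g_sigma_algebraType (B0 : set (set (based x0))).

Section norm.
Context {R : realType} {V : lmodType R}.

Record is_norm (N : V -> R) : Prop := IsNorm {
  is_norm_triangle : forall x y, N (x + y) <= N x + N y ;
  is_norm_homogeneous : forall a x, N (a *: x) = `|a| * N x ;
  is_norm_definite : forall x, N x = 0 -> x = 0 }.

Definition point_dist (N : V -> R) (z : V) (A : set V) : R :=
  inf [set N (z - y) | y in A].

End norm.

Section usc.
Context {R : realType} {d : nat} (S : set 'rV[R]_d).

(* All functions S -> [-oo, +oo]; [uscfcns] singles out usc-fcns(S). *)
Definition efun : Type := S -> \bar R.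

Definition upper_semicontinuous (f : efun) : Prop :=
  lower_semicontinuous (fun x => - f x)%E.

Definition uscfcns : set efun :=
  [set f | upper_semicontinuous f /\ exists x, f x <> -oo%E].

Definition hypo (f : efun) : set ('rV[R]_d * R^o) :=
  [set z | exists2 x : S, \val x = z.1 & (z.2%:E <= f x)%E].

End usc.

Section attouch_wets.
Context {R : realType} {d : nat} {S : set 'rV[R]_d}.
Variables (N : 'rV[R]_d * R^o -> R) (ctr : 'rV[R]_d * R^o).
Implicit Types (f g : efun S) (F : set (efun S)) (phi : efun S -> \bar R).

(* The supremum is attained (closed N-balls are compact), hence a maximum. *)
Definition aw_rho (rho : R) f g : R :=
  sup [set `|point_dist N z (hypo f) - point_dist N z (hypo g)|
      | z in [set z | N (z - ctr) <= rho]].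

Definition aw f g : R :=
  (\int[lebesgue_measure]_(rho in `[0%R, +oo[) (aw_rho rho f g * expR (- rho)))%R.

Definition aw_cvg (u : nat -> efun S) f : Prop :=
  aw (u n) f @[n --> \oo] --> (0 : R).

Definition aw_closed F : Prop := F `<=` @uscfcns R d S /\
  forall f, uscfcns f ->
    (forall e : R, 0 < e -> exists2 g, F g & aw f g < e) -> F f.

Definition aw_bounded F : Prop :=
  exists M : R, forall f g, F f -> F g -> aw f g <= M.

(* Relatively open subsets of (F, d). *)
Definition aw_open_in F : set (set (efun S)) :=
  [set U | U `<=` F /\ forall f, U f ->
     exists2 r : R, 0 < r & forall g, F g -> aw f g < r -> U g].

(* The trace on F of its sigma-algebra is the Borel sigma-algebra of (F, d). *)
Definition aw_borel F := g_sigma_algebraType (aw_open_in F).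

Definition lsc_on F phi : Prop :=
  forall (u : nat -> efun S) f, (forall n, F (u n)) -> F f -> aw_cvg u f ->
    (phi f <= limn_einf (phi \o u))%E.

Definition eps_argmin (eps : R) F phi : set (efun S) :=
  [set f | F f /\ (phi f <= ereal_inf (phi @` F) + eps%:E)%E].

Definition argmin F phi := eps_argmin 0 F phi.

(* The points a_(k i) \in A_(k i) are only chosen along the subsequence, as is
   usual for outer limits, so that a few empty A_n are harmless. *)
Definition outlim (A : nat -> set (efun S)) : set (efun S) :=
  [set f | uscfcns f /\ exists k : nat -> nat, {homo k : i j / (i < j)%N} /\
     exists a : nat -> efun S, (forall i, A (k i) (a i)) /\ aw_cvg a f].

Definition innlim (A : nat -> set (efun S)) : set (efun S) :=
  [set f | uscfcns f /\
     exists a : nat -> efun S, (forall n, A n (a n)) /\ aw_cvg a f].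

Definition set_converges (A : nat -> set (efun S)) (B : set (efun S)) : Prop :=
  outlim A = B /\ innlim A = B.

Section random_lsc.
Context {disp : measure_display} {T0 : measurableType disp}.
Variables (F : set (efun S)) (psi : T0 -> efun S -> \bar R).

(* The domain [setT `*` F] belongs to the product sigma-algebra, whose trace
   on it is the product of that of T0 with the Borel sigma-algebra of F. *)
Definition random_lsc : Prop :=
  (forall x, lsc_on F (psi x)) /\
  measurable_fun ([set: T0] `*` F : set (T0 * aw_borel F)%type)
    (fun p : (T0 * aw_borel F)%type => psi p.1 p.2).

(* [integral] is the difference of the integrals of the positive and negative
   parts with oo - oo = -oo: the condition says that the negative part of the
   infimum is integrable.  With oo - oo = oo it would also accept infima whose
   two parts have infinite integrals, to which the law of large numbers does
   not apply. *)
Definition locally_inf_integrable (P0 : {measure set T0 -> \bar R}) : Prop :=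
  forall f, F f -> exists2 r : R, 0 < r &
    (-oo < \int[P0]_x ereal_inf [set psi x g | g in [set g | F g /\ (aw f g <= r)%R]])%E.

End random_lsc.
End attouch_wets.

Section probability.
Context {R : realType} {dO : measure_display} {Omega : measurableType dO}.
Variable P : probability Omega R.

(* Expectation with the convention oo - oo = oo. *)
Definition expect (Y : Omega -> \bar R) : \bar R :=
  dual_adde (\int[P]_w (Y^\+ w))%E (- \int[P]_w (Y^\- w))%E.

Context {d0 : measure_display} {T0 : measurableType d0}.

Definition mutually_independent (X : nat -> {mfun Omega >-> T0}) : Prop :=
  forall (J : seq nat) (A : nat -> set T0), uniq J ->
    (forall j, measurable (A j)) ->
    P (\bigcap_(j in [set` J]) (X j @^-1` A j)) =
    (\prod_(j <- J) P (X j @^-1` A j))%E.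

Definition identically_distributed (X : nat -> {mfun Omega >-> T0}) : Prop :=
  forall j (A : set T0), measurable A ->
    distribution P (X j) A = distribution P (X 0%N) A.

Definition iid (X : nat -> {mfun Omega >-> T0}) : Prop :=
  mutually_independent X /\ identically_distributed X.

End probability.

(* Sequences are indexed from 0: the sample of index n is x_0, ..., x_n, of
   size n + 1.  The sum uses the convention oo - oo = oo. *)
Definition penalized_mean {R : realType} {T E : Type} (psi : T -> E -> \bar R)
    (pen : nat -> E -> R) (x : nat -> T) (n : nat) (f : E) : \bar R :=
  ((n.+1%:R^-1 : R)%:E * (\sum_(j < n.+1) psi (x j) f)%dE + (pen n f)%:E)%E.

(* Main.v *)
(** (usc-fcns(S), d) is a pseudometric space in which bounded sequences have
    cluster points: the limit along an ultrafilter of the distance functions to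
    the hypographs is again the distance function to a hypograph.  Hence F is
    separable and its balls are totally bounded, and (i) and (ii) reduce to two
    one-sided bounds on the empirical means phi_n, which together amount to
    epi-convergence to J = E[psi(X, .)].

    Upper bound: the strong law of large numbers at countably many points of F
    chosen nearly minimal for J on small balls.  Lower bound: the strong law for
    the functions x |-> min(inf_B psi(x, .), M), where B runs through a countable
    family of balls; by lower semicontinuity and monotone convergence their
    expectations approach J as B shrinks and M grows.

    The infimum over a ball is measurable by the projection theorem: as F is
    sigma-compact, Borel subsets of S0 x F arise by the Suslin operation from
    rectangles with compact second factor, and their projections are measurable
    because P0 is complete. *)

(* The exceptional null set may depend neither on f nor on the tolerances, so the strong law is
   invoked for countably many functions only; from there on the argument is deterministic. The cap M
   is needed because J may be +oo: it bounds the positive part of an infimum over a ball, and local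
   inf-integrability takes care of the negative part. Ultrafilters replace diagonal subsequences:
   along a single free one, the distance functions converge at all of their uncountably many
   arguments at once, and the same device supplies the compactness of the Suslin schemes. The
   projection theorem is Choquet's capacity argument with outer measure as the capacity. The strong
   law follows Etemadi: truncation at the block length along p 2^n, then interpolation by
   monotonicity, so that second moments of truncated variables are enough. *)
Require Import Defs.
From HB Require Import structures.
From mathcomp Require Import all_boot all_order all_algebra.
From mathcomp Require Import all_classical all_reals all_analysis measurable_realfun.
From mathcomp Require Import ring lra zify.
From Stdlib Require Cantor.
Import Order.TTheory GRing.Theory Num.Theory.
Import numFieldNormedType.Exports.

Set Implicit Arguments.
Unset Strict Implicit.
Unset Printing Implicit Defensive.

Local Open Scope classical_set_scope.
Local Open Scope ring_scope.

(** * Proper pseudometrics *)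

(* pm_proper says that bounded sequences converge along every free ultrafilter. *)
Record proper_pmetric {R : realType} {E : Type} (F : set E) (delta : E -> E -> R)
    : Prop := ProperPMetric {
  pm_ge0 : forall f g, F f -> F g -> 0 <= delta f g ;
  pm_refl : forall f, F f -> delta f f = 0 ;
  pm_sym : forall f g, F f -> F g -> delta f g = delta g f ;
  pm_triangle : forall f g h, F f -> F g -> F h ->
    delta f h <= delta f g + delta g h ;
  pm_proper : forall (U : set_system nat), UltraFilter U -> \oo `<=` U ->
    forall (u : nat -> E) c M, F c -> U [set n | F (u n) /\ delta c (u n) <= M] ->
    exists2 f, F f & forall e, 0 < e -> U [set n | delta (u n) f < e] }.

Section proper_pmetric_theory.
Context {R : realType} {E : Type} (F : set E) (delta : E -> E -> R).
Hypothesis pm : proper_pmetric F delta.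

Lemma ex2_andP T (P Q : T -> Prop) : (exists2 x, P x & Q x) -> exists x, P x /\ Q x.
Proof. by case=> x; exists x. Qed.

(** Members of a free ultrafilter are infinite, so its limit is approached at arbitrarily late
    indices. *)
Lemma pm_cluster (u : nat -> E) c M : F c -> (forall n, F (u n)) ->
  (forall n, delta c (u n) <= M) ->
  exists2 f, F f & forall (e : R) m, 0 < e -> exists2 n, (m <= n)%N & delta (u n) f < e.
Proof.
move=> Fc Fu uM.
have [U [UU ooU]] := ultraFilterLemma (eventually_filter : ProperFilter \oo).
have [|f Ff uf] := pm_proper pm UU ooU (u := u) (M := M) Fc.
  by apply: filterS filterT => n _; split.
exists f => // e m e0.
have Um : U [set n | (m <= n)%N] by apply: ooU; exists m.
by have [n [mn ufe]] := filter_ex (filterI Um (uf _ e0)); exists n.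
Qed.

(* A sequence delta-separated by a fixed e cannot be bounded. *)
Lemma pm_separable c : F c -> exists2 D : nat -> E, (forall n, F (D n)) &
  forall f (e : R), F f -> 0 < e -> exists n, delta (D n) f < e.
Proof.
move=> Fc.
have net (k M : nat) : exists2 s : seq E, (forall f, List.In f s -> F f) &
    forall f, F f -> delta c f <= M%:R ->
      exists2 g, List.In g s & delta g f < k.+1%:R^-1.
  apply: contrapT => nonet.
  have step (s : seq E) : exists f, (forall g, List.In g s -> F g) ->
     [/\ F f, delta c f <= M%:R & forall g, List.In g s -> k.+1%:R^-1 <= delta g f].
    have [sF|nsF] := pselect (forall g, List.In g s -> F g); last by exists c.
    apply: contrapT => nf; apply: nonet; exists s => // f Ff cf.
    apply: contrapT => ng; apply: nf; exists f => _; split => // g gs.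
    by rewrite leNgt; apply/negP => gf; apply: ng; exists g.
  have [next nextP] := choice step.
  (* Greedy choice: [L n] lists the first n points, and [next] picks one at distance at least
     1/(k+1) from all of them. *)
  pose L := fix L n : seq E := if n is m.+1 then next (L m) :: L m else [::].
  have LF n g : List.In g (L n) -> F g.
    elim: n g => [//|n IH] g /= [<-|]; last exact: IH.
    by have [] := nextP (L n) IH.
  pose u n := next (L n).
  have uP n : [/\ F (u n), delta c (u n) <= M%:R &
      forall g, List.In g (L n) -> k.+1%:R^-1 <= delta g (u n)].
    exact: nextP (@LF n).
  have uL i j : (i < j)%N -> List.In (u i) (L j).
    elim: j => // j IH; rewrite ltnS leq_eqVlt => /predU1P[->|/IH]; first by left.
    by right.
  have Fu n : F (u n) by have [] := uP n.
  have [|f Ff uf] := pm_cluster (u := u) (M := M%:R) Fc Fu _.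
    by move=> n; have [] := uP n.
  have e0 : 0 < k.+1%:R^-1 / 2 :> R by rewrite divr_gt0// invr_gt0.
  have [i _ ui] := uf _ 0%N e0.
  have [j ij uj] := uf _ i.+1 e0.
  have [_ _ /(_ _ (uL _ _ ij))] := uP j; apply/negP; rewrite -ltNge.
  have := pm_triangle pm (Fu i) Ff (Fu j).
  rewrite (pm_sym pm Ff (Fu j)) => /le_lt_trans; apply.
  by rewrite [ltRHS](splitr _) ltrD.
have [s sP] := choice (fun p : nat * nat => ex2_andP (net p.1 p.2)).
(* The nets of all meshes k and radii M are merged by coding (k, M, position); numbers that code
   nothing give c. *)
pose D n := if @unpickle (nat * nat * nat)%type n is Some (k, M, i)
            then List.nth i (s (k, M)) c else c.
exists D => [n|f e Ff e0].
  rewrite /D; case: unpickle => [[[k M] i]|//].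
  have [/(proj1 (sP (k, M)))//|->//] := List.nth_in_or_default i (s (k, M)) c.
have [M cM] : exists M : nat, delta c f <= M%:R.
  by exists (Num.truncn (delta c f)).+1; rewrite ltW// truncnS_gt.
have [k ke] : exists k, k.+1%:R^-1 < e.
  by exists (Num.truncn e^-1); rewrite invf_plt ?posrE// truncnS_gt.
have [g gs gf] := proj2 (sP (k, M)) f Ff cM.
have [i [_ gE]] := List.In_nth _ _ c gs.
exists (pickle (k, M, i)); rewrite /D pickleK gE; exact: lt_trans ke.
Qed.

End proper_pmetric_theory.

(** * Convergence of minimizers *)

Lemma ereal_between {R : realType} (x y : \bar R) : (x < y)%E ->
  exists b : R, (x < b%:E < y)%E.
Proof.
case: x y => [x| |] [y| |] //=.
- rewrite lte_fin => xy; exists ((x + y) / 2); rewrite !lte_fin; apply/andP; lra.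
- by move=> _; exists (x + 1); rewrite lte_fin ltry ltrDl ltr01.
- by move=> _; exists (y - 1); rewrite lte_fin ltNyr gtrBl ltr01.
- by move=> _; exists 0; rewrite ltNyr ltry.
Qed.

Section variational_convergence.
Context {R : realType} {E : Type} (F : set E) (delta : E -> E -> R).
Hypothesis pm : proper_pmetric F delta.
Variables (phi : nat -> E -> \bar R) (J : E -> \bar R).

Definition argmin_within (e : R) (f : E -> \bar R) : set E :=
  [set x | F x /\ (f x <= ereal_inf (f @` F) + e%:E)%E].

(** Neighbourhood form of the liminf half of epi-convergence: one r and one n0 serve all nearby
    points. *)
Definition liminf_below : Prop := forall f (a : R), F f -> (a%:E < J f)%E ->
  exists2 r : R, 0 < r & exists n0, forall n g, (n0 <= n)%N -> F g ->
    delta f g < r -> (a%:E <= phi n g)%E.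

(** The recovery point h is fixed in n and merely near f, so countably many points can supply it. *)
Definition limsup_above : Prop := forall f (b e : R), F f -> (J f < b%:E)%E -> 0 < e ->
  exists h, [/\ F h, delta h f < e &
    exists n0, forall n, (n0 <= n)%N -> (phi n h <= b%:E)%E].

(** The bound may depend on n. It keeps each infimum of [phi n] above -oo; since -oo + eps = -oo, an
    approximate argmin could otherwise be empty. *)
Definition locally_bounded_below : Prop := forall n f, F f ->
  exists2 r : R, 0 < r & exists b : R, forall g, F g -> delta f g < r ->
    (b%:E <= phi n g)%E.

Hypothesis LI : liminf_below.
Hypothesis UL : limsup_above.

(** If J g < b < b' < J f, a recovery point for g keeps the infimum of [phi n] at most b, while
    [phi n] is at least b' near f; eventually [eps n] is smaller than b' - b. *)
Lemma argmin_cluster (eps : nat -> R) (k : nat -> nat) (a : nat -> E) f :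
  (forall n, 0 <= eps n) -> eps n @[n --> \oo] --> (0 : R) ->
  {homo k : i j / (i < j)%N} -> (forall i, argmin_within (eps (k i)) (phi (k i)) (a i)) ->
  F f -> delta (a i) f @[i --> \oo] --> (0 : R) ->
  argmin_within 0 J f.
Proof.
move=> eps0 epsc hk aA Ff af; split => //; rewrite adde0.
apply: le_ereal_inf_tmp => _ [g Fg <-]; rewrite leNgt; apply/negP => gf.
have [b /andP[gb bf]] := ereal_between gf.
have [b' /andP[bb' b'f]] := ereal_between bf; rewrite lte_fin in bb'.
have [r r0 [n0 n0P]] := LI Ff b'f.
have [h [Fh _ [n1 n1P]]] := UL Fg gb ltr01.
have kge i : (i <= k i)%N.
  by elim: i => // i IH; apply: leq_ltn_trans IH _; exact: hk.
have epsk : \forall n \near \oo, eps n < b' - b.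
  by apply: (cvgr_lt 0 epsc); rewrite subr_gt0.
have afr : \forall i \near \oo, delta (a i) f < r by exact: (cvgr_lt 0 af).
case: epsk => n2 _ n2P; case: afr => n3 _ n3P.
pose i := maxn (maxn n0 n1) (maxn n2 n3).
have i0 : (n0 <= i)%N by rewrite /i !leq_max leqnn.
have i1 : (n1 <= i)%N by rewrite /i !leq_max leqnn orbT.
have i2 : (n2 <= i)%N by rewrite /i !leq_max leqnn !orbT.
have i3 : (n3 <= i)%N by rewrite /i !leq_max leqnn !orbT.
have [Fa aphi] := aA i.
have := n0P (k i) (a i) (leq_trans i0 (kge i)) Fa.
rewrite (pm_sym pm Ff Fa) => /(_ (n3P _ i3)); apply/negP; rewrite -ltNge.
apply: le_lt_trans aphi _.
have infb : (ereal_inf (phi (k i) @` F) <= b%:E)%E.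
  apply: le_trans (n1P (k i) (leq_trans i1 (kge i))).
  by apply: ereal_inf_lbound; exists h.
apply: (le_lt_trans (leeD2r _ infb)).
rewrite -EFinD lte_fin -ltrBrDl; exact: (n2P (k i) (leq_trans i2 (kge i))).
Qed.

Hypothesis LB : locally_bounded_below.

(** Points [u i] with [phi n (u i)] below -i would cluster at some f, against the lower bound near
    f. *)
Lemma inf_gtNy c M n : F c -> (forall f, F f -> delta c f <= M) ->
  (-oo < ereal_inf (phi n @` F))%E.
Proof.
move=> Fc FM; rewrite ltNge leeNy_eq; apply/negP => /eqP infNy.
have ex i : exists f, F f /\ (phi n f < (- i%:R)%:E)%E.
  have : (ereal_inf (phi n @` F) < (- i%:R)%:E)%E by rewrite infNy ltNyr.
  by move=> /ereal_inf_lt[_ [f Ff <-] ?]; exists f.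
have [u uP] := choice ex.
have [f Ff uf] := pm_cluster pm Fc (fun i => proj1 (uP i)) (fun i => FM _ (proj1 (uP i))).
have [r r0 [b bP]] := LB n Ff.
have [i bi ufr] := uf r (Num.truncn (- b)).+1 r0.
have [Fu] := uP i; rewrite ltNge => /negP; apply.
apply: le_trans (bP _ Fu _); last by rewrite (pm_sym pm).
rewrite lee_fin lerNl ltW// (lt_le_trans (truncnS_gt _))//.
by rewrite ler_nat.
Qed.

Hypothesis J_gtNy : forall f, F f -> (-oo < J f)%E.

(** The index n0 serves all minimizers f at once, so that one tolerance sequence can work for all of
    them. The bounds m - e on the infimum and m + e near f are both made uniform by contradiction:
    offending points cluster because F is bounded. *)
Lemma argmin_eventually_attained c M (e : R) : F c -> (forall f, F f -> delta c f <= M) ->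
  (J c < +oo)%E -> 0 < e ->
  exists n0, forall n, (n0 <= n)%N -> forall f, argmin_within 0 J f ->
    exists2 g, argmin_within (2 * e) (phi n) g & delta g f < e.
Proof.
move=> Fc FM Jc e0.
have [[f0 f0A]|nA] := pselect (exists f, argmin_within 0 J f); last first.
  by exists 0%N => n _ f fA; case: nA; exists f.
have Jeq f g : argmin_within 0 J f -> F g -> (J f <= J g)%E.
  by move=> [Ff]; rewrite adde0 => /le_trans h Fg; apply: h; apply: ereal_inf_lbound; exists g.
have [m mE] : exists m, J f0 = m%:E.
  have := J_gtNy (proj1 f0A); have := le_lt_trans (Jeq _ _ f0A Fc) Jc.
  by case: (J f0) => // m _ _; exists m.
have Jm g : F g -> (m%:E <= J g)%E by move=> Fg; rewrite -mE; exact: Jeq.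
have [n1 n1P] : exists n1, forall n, (n1 <= n)%N -> forall f, F f -> ((m - e)%:E <= phi n f)%E.
  apply: contrapT => nn.
  have ex i : exists nf : nat * E, [/\ (i <= nf.1)%N, F nf.2 & (phi nf.1 nf.2 < (m - e)%:E)%E].
    apply: contrapT => ni; apply: nn; exists i => n ni' f Ff.
    by rewrite leNgt; apply/negP => lt; apply: ni; exists (n, f).
  have [u uP] := choice ex.
  have Fu i : F (u i).2 by have [] := uP i.
  have [f Ff uf] := pm_cluster pm Fc Fu (fun i => FM _ (Fu i)).
  have [|r r0 [n0 n0P]] := LI (a := m - e) Ff.
    by apply: lt_le_trans (Jm _ Ff); rewrite lte_fin gtrBl.
  have [i n0i ufr] := uf r n0 r0.
  have [iu _] := uP i; rewrite ltNge => /negP; apply; apply: n0P => //.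
    exact: leq_trans iu.
  by rewrite (pm_sym pm).
have [n2 n2P] : exists n2, forall n, (n2 <= n)%N -> forall f, argmin_within 0 J f ->
    exists2 g, F g /\ (phi n g <= (m + e)%:E)%E & delta g f < e.
  apply: contrapT => nn.
  have ex i : exists nf : nat * E, [/\ (i <= nf.1)%N, argmin_within 0 J nf.2 &
      forall g, F g -> delta g nf.2 < e -> ~ (phi nf.1 g <= (m + e)%:E)%E].
    apply: contrapT => ni; apply: nn; exists i => n ni' f fA.
    apply: contrapT => ng; apply: ni; exists (n, f); split => // g Fg gf pg.
    by apply: ng; exists g.
  have [u uP] := choice ex.
  have Au i : argmin_within 0 J (u i).2 by have [] := uP i.
  have Fu i : F (u i).2 := proj1 (Au i).
  have [f Ff uf] := pm_cluster pm Fc Fu (fun i => FM _ (Fu i)).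
  (* h is within e / 4 of the point at i0, and the points at i0 and i are within e / 4 of f: less
     than e in total. *)
  have e4 : 0 < e / 4 by lra.
  have [i0 _ ui0] := uf (e / 4) 0%N e4.
  have Ji0 : (J (u i0).2 < (m + e)%:E)%E.
    have := Jeq _ _ (Au i0) (proj1 f0A); rewrite mE => /le_lt_trans; apply.
    by rewrite lte_fin ltrDl.
  have [h [Fh hu [n1' n1'P]]] := UL (Fu i0) Ji0 e4.
  have [i ni ui] := uf (e / 4) n1' e4.
  have [iu _ /(_ h Fh)] := uP i; apply; last first.
    by apply: n1'P; exact: leq_trans iu.
  have := pm_triangle pm Fh (Fu i0) (Fu i); have := pm_triangle pm (Fu i0) Ff (Fu i).
  by rewrite (pm_sym pm Ff (Fu i)); lra.
exists (maxn n1 n2) => n; rewrite geq_max => /andP[nn1 nn2] f fA.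
have [g [Fg pg] gf] := n2P n nn2 f fA.
exists g => //; split => //; apply: (le_trans pg).
have : ((m - e)%:E <= ereal_inf (phi n @` F))%E.
  by apply: le_ereal_inf_tmp => _ [f' Ff' <-]; exact: n1P.
move=> /(leeD2r (2 * e)%:E); apply: le_trans.
by rewrite -EFinD lee_fin; lra.
Qed.

Lemma argmin_attained c M : F c -> (forall f, F f -> delta c f <= M) ->
  (J c < +oo)%E ->
  exists eps : nat -> R, [/\ forall n, 0 <= eps n, eps n @[n --> \oo] --> (0 : R) &
    forall f, argmin_within 0 J f -> exists a : nat -> E,
      (forall n, argmin_within (eps n) (phi n) (a n)) /\
      delta (a n) f @[n --> \oo] --> (0 : R)].
Proof.
move=> Fc FM Jc.
pose e k : R := k.+1%:R^-1.
have e0 k : 0 < e k by rewrite invr_gt0.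
pose Q n k := forall f, argmin_within 0 J f ->
    exists2 g, argmin_within (2 * e k) (phi n) g & delta g f < e k.
have evQ k : exists n0, forall n, (n0 <= n)%N -> Q n k.
  exact: argmin_eventually_attained Fc FM Jc (e0 k).
have inh n : exists g, argmin_within 1 (phi n) g.
  have := inf_gtNy n Fc FM; case Ei : (ereal_inf _) => [x| |]//= _; last first.
    by exists c; split => //; rewrite Ei leey.
  have : (ereal_inf (phi n @` F) < (x + 1)%:E)%E by rewrite Ei lte_fin ltrDl.
  by move=> /ereal_inf_lt[_ [g Fg <-] lt]; exists g; split => //; rewrite Ei -EFinD ltW.
(* eps n follows the best accuracy that is guaranteed at stage n *)
pose P n := [pred k | (k <= n)%N && `[< Q n k >]].
pose kappa n : option nat := if pselect (exists k, P n k) is left ex then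
   Some (ex_maxn ex (fun i (h : P n i) => proj1 (andP h))) else None.
have kappaP n k : kappa n = Some k -> Q n k.
  by rewrite /kappa; case: pselect => // ex [<-]; case: ex_maxnP => i /andP[_ /asboolP].
have kappa_ge k : exists n0, forall n, (n0 <= n)%N -> exists2 i, kappa n = Some i & (k <= i)%N.
  have [n0 n0P] := evQ k; exists (maxn n0 k) => n; rewrite geq_max => /andP[nn kn].
  have Pk : P n k by rewrite /P/= kn/=; apply/asboolP; exact: n0P.
  rewrite /kappa; case: pselect => [ex|[]]; last by exists k.
  by eexists; first reflexivity; case: ex_maxnP => i _; apply.
have e_small (x : R) : 0 < x -> exists k, forall i, (k <= i)%N -> e i < x.
  move=> x0; exists (Num.truncn x^-1) => i ki; rewrite /e invf_plt ?posrE//.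
  by apply: lt_le_trans (truncnS_gt _) _; rewrite ler_nat.
(* Where no accuracy is guaranteed yet, the value 1 is safe: by [inh] that argmin set is inhabited,
   as [innlim] demands at every n. *)
pose eps n := if kappa n is Some k then 2 * e k else 1.
exists eps; split.
- by move=> n; rewrite /eps; case: (kappa n) => // k; rewrite mulr_ge0// ltW.
- apply/cvgr0Pnorm_lt => x x0.
  have [k kP] := e_small (x / 2) (divr_gt0 x0 (ltr0Sn _ 1)).
  have [n0 n0P] := kappa_ge k; exists n0 => // n /= /n0P[i ki kin].
  rewrite /eps ki ger0_norm ?mulr_ge0// ?ltW//.
  by have := kP _ kin; rewrite ltr_pdivlMr// mulrC.
move=> f fA.
have ex n : exists g, argmin_within (eps n) (phi n) g /\
    forall k, kappa n = Some k -> delta g f < e k.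
  rewrite /eps; case kn : (kappa n) => [k|].
    by have [g gA gf] := kappaP _ _ kn f fA; exists g; split => // _ [<-].
  by have [g gA] := inh n; exists g.
have [a aP] := choice ex.
exists a; split => [n|]; first by case: (aP n).
apply/cvgr0Pnorm_lt => x x0.
have [k kP] := e_small x x0.
have [n0 n0P] := kappa_ge k; exists n0 => // n /= /n0P[i ki kin].
have [[Fa _] /(_ _ ki) ai] := aP n.
rewrite ger0_norm ?(pm_ge0 pm)//; last by case: fA.
exact: lt_trans (kP _ kin).
Qed.

End variational_convergence.

(** * The Attouch-Wets distance is proper *)

(** An ultrafilter decides every neighbourhood, so its cluster points are limits. *)
Lemma compact_ulim {T : topologicalType} (K : set T) (U : set_system nat) (u : nat -> T) :
  compact K -> UltraFilter U -> U [set n | K (u n)] ->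
  exists2 p, K p & forall V, nbhs p V -> U [set n | V (u n)].
Proof.
move=> cK UU UK.
have [p [Kp clp]] := cK (u @ U) (fmap_proper_filter u _) UK.
exists p => // V pV.
have [//|nV] := in_ultra_setVsetC [set n | V (u n)] UU.
by have [x [nVx Vx]] := clp (~` V) V nV pV.
Qed.

Lemma real_ulim {R : realType} (U : set_system nat) (u : nat -> R) (M : R) :
  UltraFilter U -> U [set n | `|u n| <= M] ->
  exists l, forall e : R, 0 < e -> U [set n | `|u n - l| < e].
Proof.
move=> UU uM.
have [|l _ lP] := compact_ulim (u := u) (@segment_compact R (- M) M) UU.
  by apply: filterS uM => n /=; rewrite in_itv/= ler_norml.
exists l => e e0; apply: filterS (lP _ (nbhsx_ballx l e e0)) => n.
by rewrite /= /ball/= distrC.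
Qed.

(** * Norms and distance functions *)

Section norm_theory.
Context {R : realType} {V : lmodType R}.
Variable N : V -> R.
Hypothesis N_norm : is_norm N.

Lemma is_norm0 : N 0 = 0.
Proof. by rewrite -(scale0r 0) (is_norm_homogeneous N_norm) normr0 mul0r. Qed.

Lemma is_normN x : N (- x) = N x.
Proof. by rewrite -scaleN1r (is_norm_homogeneous N_norm) normrN1 mul1r. Qed.

Lemma is_normB x y : N (x - y) = N (y - x).
Proof. by rewrite -is_normN opprB. Qed.

Lemma is_norm_ge0 x : 0 <= N x.
Proof.
have := is_norm_triangle N_norm x (- x).
by rewrite subrr is_norm0 is_normN; lra.
Qed.

Lemma is_norm_dist_triangle y x z : N (x - z) <= N (x - y) + N (y - z).
Proof. by rewrite -(subrKA y) (is_norm_triangle N_norm). Qed.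

Lemma point_dist_le z A y : A y -> point_dist N z A <= N (z - y).
Proof.
move=> Ay; apply: ge_inf; last by exists y.
by exists 0 => _ [x _ <-]; exact: is_norm_ge0.
Qed.

Lemma point_dist_ge z (A : set V) a : A !=set0 -> (forall y, A y -> a <= N (z - y)) ->
  a <= point_dist N z A.
Proof.
move=> [y Ay] aN; apply: lb_le_inf; first by exists (N (z - y)), y.
by move=> _ [x Ax <-]; exact: aN.
Qed.

Lemma point_dist_ge0 z A : A !=set0 -> 0 <= point_dist N z A.
Proof. by move=> A0; apply: point_dist_ge => // y _; exact: is_norm_ge0. Qed.

Lemma point_dist_lipschitz z z' A : A !=set0 ->
  point_dist N z A <= N (z - z') + point_dist N z' A.
Proof.
move=> A0; rewrite -lerBlDl; apply: point_dist_ge => // y Ay.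
by rewrite lerBlDl (le_trans (point_dist_le _ Ay))// is_norm_dist_triangle.
Qed.

Lemma point_dist_near z (A : set V) (e : R) : A !=set0 -> 0 < e ->
  exists2 y, A y & N (z - y) < point_dist N z A + e.
Proof.
move=> [y Ay] e0.
have [|_ [x Ax <-] xe] := @inf_adherent _ [set N (z - y) | y in A] _ e0.
  split; first by exists (N (z - y)), y.
  by exists 0 => _ [x _ <-]; exact: is_norm_ge0.
by exists x.
Qed.

End norm_theory.

Lemma row_entry_norm {R : realType} d (x : 'rV[R]_d) j : `|x 0 j| <= `|x|.
Proof.
rewrite [leRHS]/Num.norm/= mx_normrE; apply/bigmax_geP; right => /=.
by exists (0, j).
Qed.

(** * Equivalence of norms and limits of bounded sequences *)

Section finite_dimension.
Context {R : realType} {d : nat}.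
Local Notation V := ('rV[R]_d * R^o)%type.
Variable N : V -> R.
Hypothesis N_norm : is_norm N.

Lemma is_norm_upper_bound : exists2 C, 0 < C & forall z : V, N z <= C * `|z|.
Proof.
pose C := \sum_(j < d) N ('e_j, 0) + N (0, 1).
have C0 : 0 <= C.
  by rewrite addr_ge0 ?(is_norm_ge0 N_norm)// sumr_ge0// => j _; exact: is_norm_ge0.
exists (C + 1); first by rewrite ltr_wpDl.
move=> [x a]; rewrite prod_normE/=.
set M := Num.max _ _.
have xM : `|x| <= M by rewrite /M le_max lexx.
have aM : `|a| <= M by rewrite /M le_max lexx orbT.
have M0 : 0 <= M := le_trans (normr_ge0 _) aM.
have H j : N (x 0 j *: 'e_j, 0) <= M * N ('e_j, 0).
  have -> : (x 0 j *: 'e_j, 0) = x 0 j *: ('e_j, 0) :> V.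
    by congr pair; rewrite /= scaler0.
  rewrite (is_norm_homogeneous N_norm) ler_wpM2r ?(is_norm_ge0 N_norm)//.
  exact: le_trans (row_entry_norm _ _) xM.
have Hx : N (x, 0) <= M * \sum_(j < d) N ('e_j, 0).
  rewrite [in leLHS](row_sum_delta x) mulr_sumr.
  elim/big_ind2 : _ => [|r y r' y' yr yr'|j _]; last exact: H.
    by rewrite (is_norm0 N_norm).
  have -> : (y + y', 0) = (y, 0) + (y', 0) :> V by congr pair; rewrite /= addr0.
  by apply: le_trans (is_norm_triangle N_norm _ _) _; exact: lerD.
have -> : (x, a) = (x, 0) + a *: (0, 1) :> V.
  by congr pair; rewrite /= ?scaler0 ?addr0// add0r [in RHS]/GRing.scale/= mulr1.
apply: le_trans (is_norm_triangle N_norm _ _) _.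
rewrite (is_norm_homogeneous N_norm) /C -addrA mulrDl mulrC lerD//.
  by rewrite mulrC.
rewrite mulrDl mul1r; apply: (le_trans (ler_wpM2l (is_norm_ge0 N_norm _) aM)).
by rewrite lerDl.
Qed.

Lemma bounded_ulim (U : set_system nat) (u : nat -> V) (M : R) :
  UltraFilter U -> U [set n | `|u n| <= M] ->
  exists l, forall e : R, 0 < e -> U [set n | `|u n - l| < e].
Proof.
move=> UU uM.
have c1 : compact [set x : 'rV[R]_d | `|x| <= M].
  apply: bounded_closed_compact.
    exists M; split; first exact: num_real.
    by move=> x Mx y /= /le_trans; apply; exact: ltW.
  apply: (@closed_comp _ _ (fun x : 'rV[R]_d => `|x|) [set r | r <= M]).
    by move=> x _; exact: norm_continuous.
  exact: closed_le.
have [|l _ lP] := compact_ulim (u := u) (compact_setX c1 (@segment_compact R (- M) M)) UU.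
  apply: filterS uM => n /=; rewrite prod_normE ge_max => /andP[? ?]; split => //=.
  by rewrite in_itv/= -ler_norml.
exists l => e e0; apply: filterS (lP _ (nbhsx_ballx l e e0)) => n /=.
by rewrite -ball_normE/= distrC.
Qed.

(** Otherwise unit vectors with N-norm below 1/(n+1) have a limit of length 1 and N-norm 0, against
    definiteness. *)
Lemma is_norm_lower_bound : exists2 c, 0 < c & forall z : V, c * `|z| <= N z.
Proof.
have [C C0 NC] := is_norm_upper_bound.
apply: contrapT => nc.
have ex n : exists z : V, `|z| = 1 /\ N z < n.+1%:R^-1.
  apply: contrapT => nz; apply: nc; exists n.+1%:R^-1; first by rewrite invr_gt0.
  move=> z; have [->|z0] := eqVneq z 0; first by rewrite normr0 mulr0 (is_norm0 N_norm).
  have z0' : 0 < `|z| by rewrite normr_gt0.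
  rewrite leNgt; apply/negP => zn; apply: nz; exists (`|z|^-1 *: z); split.
    by rewrite normrZ normrV ?unitfE ?gt_eqF// normr_id mulVf// gt_eqF.
  rewrite (is_norm_homogeneous N_norm) ger0_norm ?invr_ge0//.
  by rewrite mulrC ltr_pdivrMr.
have [u uP] := choice ex.
have [U [UU ooU]] := ultraFilterLemma (eventually_filter : ProperFilter \oo).
have [|l lP] := bounded_ulim (u := u) (M := 1) UU.
  by apply: filterS filterT => n _ /=; case: (uP n) => ->.
have l1 : `|l| = 1.
  apply/eqP; rewrite -subr_eq0 -normr_eq0; apply/eqP/le_anti; rewrite normr_ge0 andbT.
  apply/ler_addgt0Pr => e e0; rewrite add0r.
  have [n /= ule] := filter_ex (lP _ e0).
  have [un1 _] := uP n; rewrite -[X in _ - X]un1.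
  by rewrite distrC (le_trans (ler_dist_dist _ _))// ltW.
have Nl : N l = 0.
  apply/eqP; rewrite eq_le (is_norm_ge0 N_norm) andbT; apply/ler_addgt0Pr => e e0.
  rewrite add0r.
  have e2 : 0 < e / 2 by rewrite divr_gt0.
  have U1 : U [set n | n.+1%:R^-1 < e / 2].
    apply: ooU; exists (Num.truncn (e / 2)^-1) => // n /= kn.
    rewrite invf_plt ?posrE//; apply: lt_le_trans (truncnS_gt _) _.
    by rewrite ler_nat.
  have [n [/= ule ne]] := filter_ex (filterI (lP _ (divr_gt0 e2 C0)) U1).
  have [_ Nun] := uP n.
  rewrite -(subrK (u n) l) (le_trans (is_norm_triangle N_norm _ _))//.
  rewrite (splitr e) lerD//; last by rewrite ltW// (lt_trans Nun).
  rewrite (le_trans (NC _))// distrC mulrC -ler_pdivlMr// ltW//.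
have := is_norm_definite N_norm Nl => l0.
by move: l1; rewrite l0 normr0 => /eqP; rewrite eq_sym oner_eq0.
Qed.

Lemma is_norm_ulim (U : set_system nat) (u : nat -> V) (c : V) (M : R) :
  UltraFilter U -> U [set n | N (c - u n) <= M] ->
  exists l, forall e : R, 0 < e -> U [set n | N (u n - l) < e].
Proof.
move=> UU uM.
have [C C0 NC] := is_norm_upper_bound.
have [k k0 kN] := is_norm_lower_bound.
have [|l lP] := bounded_ulim (u := u) (M := `|c| + M / k) UU.
  apply: filterS uM => n /= uM.
  rewrite -(subrKC c (u n)) (le_trans (ler_normD _ _))// lerD2l ler_pdivlMr//.
  by rewrite mulrC distrC (le_trans (kN _)).
exists l => e e0; apply: filterS (lP _ (divr_gt0 e0 C0)) => n /=.
by rewrite ltr_pdivlMr// mulrC; exact: le_lt_trans.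
Qed.

End finite_dimension.

Lemma integrable_addr {d} {T : measurableType d} {R : realType}
    (mu : {measure set T -> \bar R}) (D : set T) (f g : T -> R) : measurable D ->
  mu.-integrable D (EFin \o f) -> mu.-integrable D (EFin \o g) ->
  mu.-integrable D (EFin \o (fun x => f x + g x)).
Proof. by move=> mD fi gi; exact: (integrableD mD fi gi). Qed.

(** * Pseudometric axioms and tail bounds for the Attouch-Wets distance *)

Section aw_rho_theory.
Context {R : realType} {d : nat} {S : set 'rV[R]_d}.
Local Notation V := ('rV[R]_d * R^o)%type.
Variables (N : V -> R) (ctr : V).
Hypothesis N_norm : is_norm N.
Implicit Types f g h : efun S.

Definition dist_gap f g (z : V) : R :=
  `|point_dist N z (hypo f) - point_dist N z (hypo g)|.

Lemma dist_gap_lipschitz f g z z' : hypo f !=set0 -> hypo g !=set0 ->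
  dist_gap f g z <= dist_gap f g z' + 2 * N (z - z').
Proof.
move=> f0 g0; rewrite /dist_gap.
have := point_dist_lipschitz N_norm z z' f0.
have := point_dist_lipschitz N_norm z z' g0.
have := point_dist_lipschitz N_norm z' z f0.
have := point_dist_lipschitz N_norm z' z g0.
rewrite (is_normB N_norm z' z).
move: (point_dist _ _ _) (point_dist _ _ _) (point_dist _ _ _) (point_dist _ _ _) => a b a' b'.
by move=> h1 h2 h3 h4; rewrite ler_norml; have := ler_norm (b' - b); have := ler_norm (b - b');
  rewrite (distrC b' b); move=> ? ?; apply/andP; split; lra.
Qed.

Lemma aw_rho_le f g rho C : 0 <= C -> (forall z, N (z - ctr) <= rho -> dist_gap f g z <= C) ->
  aw_rho N ctr rho f g <= C.
Proof.
move=> C0 fgC; have [rho0|rho0] := leP 0 rho.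
  apply: ge_sup; first by exists (dist_gap f g ctr), ctr => //=; rewrite subrr (is_norm0 N_norm).
  by move=> _ [z /= zr <-]; exact: fgC.
(* A negative radius leaves an empty set, whose [sup] is 0; this is where 0 <= C enters. *)
rewrite /aw_rho (_ : [set _ | _ in _] = set0) ?sup0//.
rewrite -subset0 => _ [z /= zr _].
by have := le_lt_trans (le_trans (is_norm_ge0 N_norm _) zr) rho0; rewrite ltxx.
Qed.

Lemma aw_rho_ub f g rho z : hypo f !=set0 -> hypo g !=set0 -> N (z - ctr) <= rho ->
  dist_gap f g z <= aw_rho N ctr rho f g.
Proof.
move=> f0 g0 zr; apply: sup_upper_bound; last by exists z.
split; first by exists (dist_gap f g z), z.
exists (dist_gap f g ctr + 2 * rho) => _ [x /= xr <-].
apply: le_trans (dist_gap_lipschitz _ ctr f0 g0) _.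
by rewrite lerD2l ler_pM2l.
Qed.

Lemma aw_rho_ge0 f g rho : hypo f !=set0 -> hypo g !=set0 -> 0 <= aw_rho N ctr rho f g.
Proof.
move=> f0 g0; have [rho0|rho0] := leP 0 rho.
  by apply: le_trans (aw_rho_ub f0 g0 (z := ctr) _); rewrite ?normr_ge0 ?subrr ?(is_norm0 N_norm).
rewrite /aw_rho (_ : [set _ | _ in _] = set0) ?sup0//.
rewrite -subset0 => _ [z /= zr _].
by have := le_lt_trans (le_trans (is_norm_ge0 N_norm _) zr) rho0; rewrite ltxx.
Qed.

Lemma aw_rho_nondecreasing f g : hypo f !=set0 -> hypo g !=set0 ->
  {homo (fun rho => aw_rho N ctr rho f g) : x y / x <= y}.
Proof.
move=> f0 g0 x y xy; apply: aw_rho_le; first exact: aw_rho_ge0.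
by move=> z zx; apply: aw_rho_ub => //; exact: le_trans xy.
Qed.

(* aw_rho is 2-Lipschitz in rho, and rho - M <= 2 exp ((rho - M) / 2); the
   exponential is integrable against exp (- rho). *)
Lemma aw_rho_growth f g M rho : hypo f !=set0 -> hypo g !=set0 -> 0 <= M ->
  aw_rho N ctr rho f g <= aw_rho N ctr M f g + 4 * (expR (- (M / 2)) * expR (rho / 2)).
Proof.
move=> f0 g0 M0; have e0 : 0 <= 4 * (expR (- (M / 2)) * expR (rho / 2)).
  by rewrite !mulr_ge0 ?expR_ge0.
apply: aw_rho_le; first by rewrite addr_ge0 ?aw_rho_ge0.
move=> z zr; have [zM|zM] := leP (N (z - ctr)) M.
  by rewrite ler_wpDr// aw_rho_ub.
set t := N (z - ctr) in zr zM *.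
have t0 : 0 < t by exact: le_lt_trans M0 zM.
(* Radial projection of z onto the ball of radius M, at N-distance exactly t - M from z. *)
pose z' := ctr + (M / t) *: (z - ctr).
have z'M : N (z' - ctr) <= M.
  rewrite /z' addrAC subrr add0r (is_norm_homogeneous N_norm) ger0_norm ?divr_ge0 ?(ltW t0)//.
  by rewrite -/t divfK ?gt_eqF.
have zz' : N (z - z') = t - M.
  have -> : z - z' = (1 - M / t) *: (z - ctr) by rewrite /z' opprD addrA scalerBl scale1r.
  rewrite (is_norm_homogeneous N_norm) ger0_norm -/t.
    by rewrite mulrBl mul1r divfK ?gt_eqF.
  by rewrite subr_ge0 ler_pdivrMr// mul1r ltW.
apply: le_trans (dist_gap_lipschitz _ z' f0 g0) _.
rewrite lerD ?aw_rho_ub// zz' -expRD.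
have := expR_ge1Dx (- (M / 2) + rho / 2); lra.
Qed.

Lemma aw_rho_triangle f g h rho : hypo f !=set0 -> hypo g !=set0 -> hypo h !=set0 ->
  aw_rho N ctr rho f h <= aw_rho N ctr rho f g + aw_rho N ctr rho g h.
Proof.
move=> f0 g0 h0; apply: aw_rho_le; first by rewrite addr_ge0// aw_rho_ge0.
move=> z zr; apply: le_trans (lerD (aw_rho_ub f0 g0 zr) (aw_rho_ub g0 h0 zr)).
exact: ler_distD.
Qed.

Lemma aw_rho_sym f g rho : aw_rho N ctr rho f g = aw_rho N ctr rho g f.
Proof.
by rewrite /aw_rho; congr sup; apply: eq_imagel => z _; rewrite distrC.
Qed.

Lemma aw_rho_refl f rho : hypo f !=set0 -> aw_rho N ctr rho f f = 0.
Proof.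
move=> f0; apply/le_anti; rewrite aw_rho_ge0// andbT; apply: aw_rho_le => // z _.
by rewrite /dist_gap subrr normr0.
Qed.

Local Notation mu := (@lebesgue_measure R).
Local Notation D := (`[0, +oo[%classic : set R).

(** Normalization of the exponential density of rate a. *)
Lemma integral_expRN (a : R) : 0 < a ->
  (\int[mu]_(x in D) (expR (- a * x))%:E = (a^-1)%:E)%E.
Proof.
move=> a0; have := integral_exponential_pdf a0.
have -> : (\int[mu]_x (exponential_pdf a x)%:E =
    \int[mu]_(x in D) (a%:E * (expR (- a * x))%:E))%E.
  rewrite [RHS]integral_mkcond; apply: eq_integral => x _.
  by rewrite /exponential_pdf !patchE; case: ifP.
rewrite ge0_integralZl//=; last 2 first.
- by apply/measurable_EFinP; apply: measurableT_comp => //; apply: measurable_funM.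
- by rewrite lee_fin ltW.
move=> /(congr1 (fun x => (a^-1)%:E * x)%E).
by rewrite muleA -EFinM mulVf ?gt_eqF// mul1e mule1.
Qed.

Lemma integrable_expRN (a c : R) : 0 < a ->
  mu.-integrable D (EFin \o (fun x => c * expR (- a * x))).
Proof.
move=> a0; rewrite (_ : _ \o _ = (fun x => c%:E * (expR (- a * x))%:E)%E)//.
apply: integrableZl => //; apply/integrableP; split.
  by apply/measurable_EFinP; apply: measurableT_comp => //; apply: measurable_funM.
under eq_integral do rewrite gee0_abs ?lee_fin ?expR_ge0//.
by rewrite integral_expRN// ltry.
Qed.

Lemma Rintegral_expRN (a c : R) : 0 < a ->
  \int[mu]_(x in D) (c * expR (- a * x)) = c / a.
Proof.
move=> a0; rewrite RintegralZl//.
  by rewrite /Rintegral integral_expRN.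
have := @integrable_expRN a 1 a0.
by under [X in mu.-integrable _ (_ \o X)]eq_fun do rewrite mul1r.
Qed.

Lemma aw_majorant_expR (c M x : R) :
  (c + 4 * (expR (- (M / 2)) * expR (x / 2))) * expR (- x) =
  c * expR (- 1 * x) + (4 * expR (- (M / 2))) * expR (- 2^-1 * x).
Proof.
have -> : expR (- 2^-1 * x) = expR (x / 2) * expR (- x).
  by rewrite -expRD; congr expR; lra.
have -> : - 1 * x = - x by rewrite mulN1r.
ring.
Qed.

Lemma aw_integrand_le f g M x : hypo f !=set0 -> hypo g !=set0 -> 0 <= M ->
  aw_rho N ctr x f g * expR (- x) <=
  aw_rho N ctr M f g * expR (- 1 * x) + (4 * expR (- (M / 2))) * expR (- 2^-1 * x).
Proof.
move=> f0 g0 M0; rewrite -aw_majorant_expR ler_wpM2r ?expR_ge0//.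
exact: aw_rho_growth.
Qed.

Lemma aw_majorant_integrable (b c : R) : mu.-integrable D (EFin \o
  (fun x => b * expR (- 1 * x) + c * expR (- 2^-1 * x))).
Proof.
by apply: integrable_addr => //; apply: integrable_expRN; rewrite ?invr_gt0.
Qed.

(** Monotonicity in rho gives measurability, the growth bound with M = 0 gives domination. *)
Lemma aw_integrable f g : hypo f !=set0 -> hypo g !=set0 ->
  mu.-integrable D (EFin \o (fun x => aw_rho N ctr x f g * expR (- x))).
Proof.
move=> f0 g0; apply: le_integrable (aw_majorant_integrable (aw_rho N ctr 0 f g) (4 * expR (- (0 / 2)))) => //.
  apply/measurable_EFinP; apply: measurable_funM.
    by apply: nondecreasing_measurable => //; exact: aw_rho_nondecreasing.
  by apply: measurableT_comp => //.
move=> x _ /=; rewrite lee_fin !ger0_norm.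
- exact: aw_integrand_le.
- by rewrite addr_ge0// !mulr_ge0 ?aw_rho_ge0// ?expR_ge0.
- by rewrite mulr_ge0 ?aw_rho_ge0// expR_ge0.
Qed.

Lemma aw_ge0 f g : hypo f !=set0 -> hypo g !=set0 -> 0 <= aw N ctr f g.
Proof.
by move=> f0 g0; apply: Rintegral_ge0 => x _; rewrite mulr_ge0 ?aw_rho_ge0// expR_ge0.
Qed.

Lemma aw_sym f g : aw N ctr f g = aw N ctr g f.
Proof. by rewrite /aw; under eq_Rintegral do rewrite aw_rho_sym. Qed.

Lemma aw_refl f : hypo f !=set0 -> aw N ctr f f = 0.
Proof.
move=> f0; rewrite /aw; under eq_Rintegral do rewrite aw_rho_refl// mul0r.
by rewrite Rintegral_cst// mul0r.
Qed.

Lemma aw_triangle f g h : hypo f !=set0 -> hypo g !=set0 -> hypo h !=set0 ->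
  aw N ctr f h <= aw N ctr f g + aw N ctr g h.
Proof.
move=> f0 g0 h0; rewrite /aw -RintegralD//; [|exact: aw_integrable..].
apply: le_Rintegral => //; first exact: aw_integrable.
  by apply: integrable_addr => //; exact: aw_integrable.
move=> x _; rewrite -mulrDl ler_wpM2r ?expR_ge0//; exact: aw_rho_triangle.
Qed.

(** [aw_rho] is nondecreasing and exp (- rho) has mass 1. Radius 0 leaves only z = ctr, so a bound
    on [aw] bounds the distance from [ctr] to a hypograph. *)
Lemma aw_ge_rho0 f g : hypo f !=set0 -> hypo g !=set0 ->
  aw_rho N ctr 0 f g <= aw N ctr f g.
Proof.
move=> f0 g0; have := @Rintegral_expRN 1 (aw_rho N ctr 0 f g) ltr01.
rewrite divr1 => <-; apply: le_Rintegral => //.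
- exact: integrable_expRN.
- exact: aw_integrable.
- move=> x; rewrite /= in_itv/= andbT => x0; rewrite mulN1r ler_wpM2r ?expR_ge0//.
  exact: aw_rho_nondecreasing.
Qed.

(** One large ball controls [aw] up to a tail: 4 exp (- M / 2) exp (- rho / 2) integrates to 8 exp
    (- M / 2). *)
Lemma aw_le f g M : hypo f !=set0 -> hypo g !=set0 -> 0 <= M ->
  aw N ctr f g <= aw_rho N ctr M f g + 8 * expR (- (M / 2)).
Proof.
move=> f0 g0 M0.
have -> : aw_rho N ctr M f g + 8 * expR (- (M / 2)) =
  \int[mu]_(x in D) (aw_rho N ctr M f g * expR (- 1 * x) +
     (4 * expR (- (M / 2))) * expR (- 2^-1 * x)).
  rewrite RintegralD// ?Rintegral_expRN//; first by field.
  - exact: integrable_expRN.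
  - by apply: integrable_expRN; rewrite invr_gt0.
apply: le_Rintegral => //; first exact: aw_integrable.
  exact: aw_majorant_integrable.
by move=> x _; exact: aw_integrand_le.
Qed.

End aw_rho_theory.

(** * Limits of hypographs along an ultrafilter *)

Section aw_proper.
Context {R : realType} {d : nat} {S : set 'rV[R]_d}.
Local Notation V := ('rV[R]_d * R^o)%type.
Variables (N : V -> R) (ctr : V).
Hypothesis N_norm : is_norm N.
Hypothesis S_closed : closed S.

Lemma uscfcns_hypo (f : efun S) : uscfcns f -> hypo f !=set0.
Proof.
move=> [_ [x fx]].
have [a af] : exists a : R, (a%:E <= f x)%E.
  by case: (f x) fx => [r| |] // _; [exists r|exists 0; rewrite leey].
by exists (\val x, a), x.
Qed.

(** Hypographs are stable under lowering. In this form the property passes to the limit of the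
    distance functions and makes its zero set a hypograph. *)
Lemma hypo_translate (f : efun S) (x : 'rV[R]_d) (a t : R) : 0 <= t ->
  hypo f !=set0 -> point_dist N (x, a - t) (hypo f) <= point_dist N (x, a) (hypo f).
Proof.
move=> t0 f0; apply: point_dist_ge => // -[y b] [s /= sy bf].
have : hypo f (y, b - t).
  exists s => //=; apply: le_trans bf; rewrite lee_fin; lra.
move=> /(point_dist_le N_norm (x, a - t)) /le_trans; apply.
have -> : (x, a - t) - (y, b - t) = (x, a) - (y, b) :> V.
  by congr pair; rewrite /= opprB addrA subrK.
by [].
Qed.

Section limit.
Variables (U : set_system nat) (u : nat -> efun S) (D : V -> R).
Hypothesis UU : UltraFilter U.
Hypothesis ooU : \oo `<=` U.
Hypothesis u0 : U [set n | hypo (u n) !=set0].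
Hypothesis DP : forall z (e : R), 0 < e ->
  U [set n | `|point_dist N z (hypo (u n)) - D z| < e].

Lemma ulim_ge z (a : R) : U [set n | a <= point_dist N z (hypo (u n))] -> a <= D z.
Proof.
move=> Ua; apply/ler_addgt0Pr => e e0.
have [n [/= an]] := filter_ex (filterI Ua (DP z e0)).
by rewrite ltr_norml => /andP[_]; lra.
Qed.

Lemma ulim_le z (a : R) : U [set n | point_dist N z (hypo (u n)) <= a] -> D z <= a.
Proof.
move=> Ua; apply/ler_addgt0Pr => e e0.
have [n [/= an]] := filter_ex (filterI Ua (DP z e0)).
by rewrite ltr_norml => /andP[+ _]; lra.
Qed.

Lemma ulim_ge0 z : 0 <= D z.
Proof. by apply: ulim_ge; apply: filterS u0 => n; exact: point_dist_ge0. Qed.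

Lemma ulim_lipschitz z z' : D z <= N (z - z') + D z'.
Proof.
apply/ler_addgt0Pr => e e0; apply: ulim_le.
apply: filterS (filterI u0 (DP z' e0)) => n [/= un].
rewrite ltr_norml => /andP[_ h].
by have := point_dist_lipschitz N_norm z z' un; lra.
Qed.

Lemma ulim_translate x (a b : R) : b <= a -> D (x, b) <= D (x, a).
Proof.
move=> ba; apply/ler_addgt0Pr => e e0; apply: ulim_le.
apply: filterS (filterI u0 (DP (x, a) e0)) => n [/= un].
rewrite ltr_norml => /andP[_ h].
have ab0 : 0 <= a - b by rewrite subr_ge0.
have := hypo_translate x a ab0 un; rewrite subKr; lra.
Qed.

(** Nearly closest points of the hypographs stay bounded and converge along U to a zero of D. Hence
    D is the distance to its own zero set. *)
Lemma ulim_attained z : exists2 y, D y = 0 & N (z - y) <= D z.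
Proof.
have ex n : exists y : V, hypo (u n) !=set0 ->
    hypo (u n) y /\ N (z - y) < point_dist N z (hypo (u n)) + n.+1%:R^-1.
  have [un|nun] := pselect (hypo (u n) !=set0); last by exists z.
  have [|y yn yz] := point_dist_near N_norm z un (e := n.+1%:R^-1).
    by rewrite invr_gt0.
  by exists y.
have [y yP] := choice ex.
have n1 n : n.+1%:R^-1 <= 1 :> R by rewrite invf_ple ?posrE// invr1 ler1n.
(* In [D z + 2], one unit covers the deviation from [D z], the other the slack 1/(n+1). *)
have [|l lP] := is_norm_ulim N_norm (u := y) (c := z) (M := D z + 2) UU.
  apply: filterS (filterI u0 (DP z ltr01)) => n [/= un].
  rewrite ltr_norml => /andP[_ h].
  have [_] := yP n un; have := n1 n; move: (_^-1) => q; lra.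
have Dl : D l = 0.
  apply/le_anti; rewrite ulim_ge0 andbT; apply/ler_addgt0Pr => e e0; rewrite add0r.
  apply: ulim_le; apply: filterS (filterI u0 (lP _ e0)) => n [/= un h].
  have [yn _] := yP n un.
  by rewrite (le_trans (point_dist_le N_norm _ yn))// (is_normB N_norm) ltW.
exists l => //; apply/ler_addgt0Pr => e e0.
have e3 : 0 < e / 3 by lra.
have U1 : U [set n | n.+1%:R^-1 < e / 3].
  apply: ooU; exists (Num.truncn (e / 3)^-1) => // n /= kn.
  by rewrite invf_plt ?posrE//; apply: lt_le_trans (truncnS_gt _) _; rewrite ler_nat.
have [n [[/= un U1n] [ln]]] := filter_ex (filterI (filterI u0 U1) (filterI (lP _ e3) (DP z e3))).
rewrite /= ltr_norml => /andP[_ h].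
have [_] := yP n un; have := is_norm_dist_triangle N_norm (y n) z l.
move: U1n => /=; move: (n.+1%:R^-1) => q; lra.
Qed.

(** The upper boundary of the zero set of D, with value -oo where no zero lies over x. *)
Definition ulim_fun : efun S := fun x => ereal_sup [set a%:E | a in [set a | D (\val x, a) = 0]].

(** Continuity and downward monotonicity of D put the supremum itself into the zero set; closedness
    of S puts the zero set over S. *)
Lemma hypo_ulim_fun : hypo ulim_fun = [set z | D z = 0].
Proof.
apply/seteqP; split => [[x a] [s /= sx afx]|[x a] /= Dxa].
  apply/le_anti; rewrite ulim_ge0 andbT; apply/ler_addgt0Pr => e e0; rewrite add0r.
  (* Lowering a by t brings it strictly below the supremum and changes D by at most e. *)
  have [t t0 te] : exists2 t, 0 < t & t * N (0, 1) <= e.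
    exists (e / (N (0, 1) + 1)); first by rewrite divr_gt0// ltr_wpDl// is_norm_ge0.
    rewrite -mulrA ger_pMr// mulrC ler_pdivrMr ?mul1r ?lerDl//.
    by rewrite ltr_wpDl// is_norm_ge0.
  have : ((a - t)%:E < ulim_fun s)%E by apply: lt_le_trans afx; rewrite lte_fin gtrBl.
  move=> /ereal_sup_gt[_ [b Db <-]]; rewrite lte_fin => /ltW atb.
  move: Db => /=; rewrite sx => Db.
  apply: le_trans (ulim_lipschitz _ (x, a - t)) _.
  have := ulim_translate x atb; rewrite Db => Dt.
  apply: le_trans (lerD (lexx _) Dt) _; rewrite addr0.
  have -> : (x, a) - (x, a - t) = t *: (0, 1) :> V.
    congr pair; rewrite /= ?subrr ?scaler0//.
    by rewrite opprB addrCA subrr addr0 [in RHS]/GRing.scale/= mulr1.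
  by rewrite (is_norm_homogeneous N_norm) gtr0_norm.
have Sx : S x.
  apply: S_closed => B /nbhs_ballP[e /= e0 eB].
  have [k k0 kN] := is_norm_lower_bound N_norm.
  have ke0 : 0 < k * e by rewrite mulr_gt0.
  have [n [/= un]] := filter_ex (filterI u0 (DP (x, a) ke0)).
  rewrite Dxa subr0 ger0_norm ?point_dist_ge0// -subr_gt0 => dk.
  have [y yn yd] := point_dist_near N_norm (x, a) un dk.
  case: y yn yd => y b [s /= sy _] yd.
  exists y; split; first by rewrite -sy; exact: (set_valP s).
  apply: eB; rewrite -ball_normE /=.
  have : `|x - y| <= `|(x, a) - (y, b) : V| by rewrite prod_normE/= le_max lexx.
  move=> /le_lt_trans; apply; rewrite -(ltr_pM2l k0).
  by apply: le_lt_trans (kN _) _; move: yd; rewrite addrCA subrr addr0.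
exists (exist _ x (mem_set Sx)) => //=.
by apply: ereal_sup_ubound; exists a.
Qed.

Lemma point_dist_ulim_fun z : point_dist N z (hypo ulim_fun) = D z.
Proof.
rewrite hypo_ulim_fun; have [y Dy zy] := ulim_attained z.
apply/le_anti/andP; split; first exact: le_trans (point_dist_le N_norm _ Dy) zy.
apply: point_dist_ge; first by exists y.
by move=> x /= Dx; have := ulim_lipschitz z x; rewrite Dx addr0.
Qed.

(** If b exceeds the value at x, then D is positive at (x, b); by the Lipschitz bound and downward
    monotonicity D has no zero at height b or above over points near x. *)
Lemma uscfcns_ulim_fun : uscfcns ulim_fun.
Proof.
split; last first.
  have [y Dy _] := ulim_attained ctr.
  have : hypo ulim_fun y by rewrite hypo_ulim_fun.
  by move=> [s _ ys]; exists s => fs; move: ys; rewrite fs leeNy_eq.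
move=> x a; rewrite lteNr => fxa.
have [b /andP[xb ba]] : exists b : R, (ulim_fun x < b%:E < - a%:E)%E.
  case: (ulim_fun x) fxa => [r| |] //=.
    by rewrite lte_fin => ra; exists ((r + - a) / 2); rewrite !lte_fin; apply/andP; split; lra.
  by move=> _; exists (- a - 1); rewrite ltNyr/= lte_fin gtrBl.
have D0 : 0 < D (\val x, b).
  rewrite lt_neqAle ulim_ge0 andbT; apply/eqP => Db; move: xb; rewrite ltNge => /negP; apply.
  by apply: ereal_sup_ubound; exists b.
have [C C0 NC] := is_norm_upper_bound N_norm.
exists (\val @^-1` ball (\val x) (D (\val x, b) / C)).
  apply: initial_continuous; apply: nbhsx_ballx; exact: divr_gt0.
move=> y /=; rewrite -ball_normE /= ltr_pdivlMr// mulrC => xy.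
rewrite lteNr; apply: le_lt_trans ba.
apply: ge_ereal_sup => _ [b' /= Db' <-]; rewrite lee_fin leNgt; apply/negP => /ltW bb'.
have := ulim_translate (\val y) bb'; rewrite Db' => Dy.
have := le_trans (ulim_lipschitz (\val x, b) (\val y, b)) (lerD (lexx _) Dy).
rewrite addr0 leNgt => /negP; apply; apply: le_lt_trans (NC _) _.
apply: le_lt_trans xy; rewrite ler_pM2l//.
by rewrite prod_normE/= subrr normr0 ge_max lexx normr_ge0.
Qed.

(** Pointwise convergence is uniform on balls: points where the gap exceeds e would converge along U
    to some l, and the gaps are 2-Lipschitz, so the gap there is below e / 4 + 2 (e / 4). *)
Lemma aw_rho_ulim_fun M e : 0 < e -> U [set n | aw_rho N ctr M (u n) ulim_fun <= e].
Proof.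
move=> e0; have [//|nU] := in_ultra_setVsetC [set n | aw_rho N ctr M (u n) ulim_fun <= e] UU.
have ex n : exists z, ~ aw_rho N ctr M (u n) ulim_fun <= e ->
    N (ctr - z) <= M /\ e < dist_gap N (u n) ulim_fun z.
  have [|ne] := pselect (aw_rho N ctr M (u n) ulim_fun <= e); first by exists ctr.
  apply: contrapT => nz; apply: ne; apply: aw_rho_le => //; first exact: ltW.
  move=> z zM; rewrite leNgt; apply/negP => ez; apply: nz; exists z.
  by rewrite (is_normB N_norm).
have [z zP] := choice ex.
have [|l lP] := is_norm_ulim N_norm (u := z) (c := ctr) (M := M) UU.
  by apply: filterS nU => n /= /zP[].
have e4 : 0 < e / 4 by lra.
have f0 := uscfcns_hypo uscfcns_ulim_fun.
have [n [[/= un ne] [/= ln]]] := filter_ex (filterI (filterI u0 nU) (filterI (lP _ e4) (DP l e4))).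
rewrite /= -point_dist_ulim_fun -/(dist_gap N (u n) ulim_fun l) => gl.
have [_] := zP n ne; have := dist_gap_lipschitz N_norm (z n) l un f0; lra.
Qed.

End limit.

Lemma aw_proper_pmetric (F : set (efun S)) : aw_closed N ctr F ->
  proper_pmetric F (aw N ctr).
Proof.
move=> [Fusc Fcl]; have F0 f : F f -> hypo f !=set0 by move=> /Fusc; exact: uscfcns_hypo.
split.
- by move=> f g /F0 f0 /F0 g0; exact: aw_ge0.
- by move=> f /F0 f0; exact: aw_refl.
- by move=> f g _ _; exact: aw_sym.
- by move=> f g h /F0 f0 /F0 g0 /F0 h0; exact: aw_triangle.
move=> U UU ooU u c M Fc UM.
have u0 : U [set n | hypo (u n) !=set0] by apply: filterS UM => n [/F0].
have c0 := F0 _ Fc.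
(* The distances from z are bounded along U because those from [ctr] are, through [aw_ge_rho0]. *)
have exD z : exists l, forall e : R, 0 < e -> U [set n | `|point_dist N z (hypo (u n)) - l| < e].
  apply: (@real_ulim _ _ _ (N (z - ctr) + point_dist N ctr (hypo c) + M) UU).
  apply: filterS UM => n /= [/F0 un cun].
  rewrite ger0_norm ?point_dist_ge0//.
  apply: le_trans (point_dist_lipschitz N_norm z ctr un) _; rewrite -addrA lerD2l.
  have := le_trans (aw_ge_rho0 ctr N_norm c0 un) cun.
  have := aw_rho_ub N_norm c0 un (rho := 0) (z := ctr) (ctr := ctr).
  rewrite subrr (is_norm0 N_norm) lexx => /(_ isT) /le_trans h /h.
  by rewrite /dist_gap ler_norml => /andP[]; lra.
have [D DP] := choice exD.
pose f := ulim_fun D.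
have fusc : uscfcns f := uscfcns_ulim_fun UU ooU u0 DP.
have f0 := uscfcns_hypo fusc.
have fU e : 0 < e -> U [set n | F (u n) /\ aw N ctr (u n) f < e].
  move=> e0; have e2 : 0 < e / 2 by lra.
  (* Radius 32 / e leaves the tail 8 exp (- 16 / e), less than e / 2 since exp t > t. *)
  apply: filterS (filterI UM (aw_rho_ulim_fun UU ooU u0 DP (2 * (16 / e)) e2)) => n /= [[Fu _] r].
  split => //; apply: le_lt_trans (aw_le ctr N_norm (F0 _ Fu) f0 (M := 2 * (16 / e)) _) _.
    by rewrite mulr_ge0// divr_ge0// ltW.
  have -> : 2 * (16 / e) / 2 = 16 / e by rewrite mulrC mulKf.
  have : expR (- (16 / e)) < e / 16.
    rewrite expRN invf_plt ?posrE ?expR_gt0 ?divr_gt0// invf_div.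
    by apply: lt_le_trans (expR_ge1Dx _); rewrite ltrDr.
  lra.
exists f.
  apply: Fcl => // e e0; have [n [Fu une]] := filter_ex (fU e e0).
  by exists (u n); [exact: Fu|rewrite (aw_sym N ctr f (u n)); exact: une].
by move=> e e0; apply: filterS (fU e e0) => n [].
Qed.

End aw_proper.

(** * The measurable projection theorem *)

Section outer_continuity.
Context {disp : measure_display} {T : measurableType disp} {R : realType}.
Variable mu : {finite_measure set T -> \bar R}.

Definition outer_ge (a : R) (A : set T) : Prop :=
  forall B, measurable B -> A `<=` B -> (a%:E <= mu B)%E.

(** Measurable covers [B n] can be replaced by the intersections of all [B k] with k >= n. These
    increase and still contain [A n], so continuity of mu applies although [A n] is arbitrary. *)
Lemma outer_ge_bigcup (A : nat -> set T) (a b : R) : {homo A : n m / (n <= m)%N >-> n `<=` m} ->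
  a < b -> outer_ge b (\bigcup_n A n) -> exists n, outer_ge a (A n).
Proof.
move=> homA ab bA; apply: contrapT => nA.
have ex n : exists B, [/\ measurable B, A n `<=` B & (mu B < a%:E)%E].
  apply: contrapT => nB; apply: nA; exists n => B mB AB; rewrite leNgt; apply/negP => Ba.
  by apply: nB; exists B.
have [B BP] := choice ex.
have mB n : measurable (B n) by have [] := BP n.
pose C n := \bigcap_(k in [set k | (n <= k)%N]) B k.
have mC n : measurable (C n) by apply: bigcap_measurableType => k _; exact: mB.
have mUC : measurable (\bigcup_n C n) by exact: bigcupT_measurable.
have subC : \bigcup_n A n `<=` \bigcup_n C n.
  move=> x [n _ Anx]; exists n => // k /= nk.
  by have [_ + _] := BP k; apply; exact: homA Anx.
have := bA _ mUC subC; apply/negP; rewrite -ltNge.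
have homC : {homo C : n m / (n <= m)%N >-> (n <= m)%O}.
  by move=> n m nm; apply/subsetPset => x Cnx k /= mk; apply: Cnx => /=; exact: leq_trans mk.
have lim := nondecreasing_cvg_mu (mu := mu) mC mUC homC.
apply: (@le_lt_trans _ _ a%:E); last by rewrite lte_fin.
rewrite -(cvg_lim _ lim)//; apply: lime_le; first by apply/cvg_ex; eexists; exact: lim.
apply: nearW => n /=; have [_ _ /ltW] := BP n; apply: le_trans.
by apply: le_measure; rewrite ?inE// => x; apply => /=.
Qed.

(** Measurable sets inside and around A have measures approaching the same number [inf X], so A is a
    measurable set plus part of a null set. *)
Lemma complete_measurable (A : set T) : measure_is_complete mu ->
  (forall a b : R, a < b -> outer_ge b A ->
    exists Z, [/\ measurable Z, Z `<=` A & (a%:E <= mu Z)%E]) ->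
  measurable A.
Proof.
move=> compl appr.
pose m (B : set T) := fine (mu B).
have mE B : measurable B -> mu B = (m B)%:E.
  by move=> mB; rewrite /m fineK//; exact: fin_num_measure.
have m0 B : 0 <= m B by rewrite fine_ge0.
pose X := [set m B | B in [set B | measurable B /\ A `<=` B]].
have hX : has_inf X.
  split; first by exists (m setT), setT.
  by exists 0 => _ [B _ <-].
have outc : outer_ge (inf X) A.
  move=> B mB AB; rewrite mE// lee_fin; apply: ge_inf; first by case: hX.
  by exists B.
have exZ n : exists Z, [/\ measurable Z, Z `<=` A & inf X - n.+1%:R^-1 <= m Z].
  have [|Z [mZ ZA aZ]] := appr (inf X - n.+1%:R^-1) _ _ outc.
    by rewrite gtrBl invr_gt0.
  by exists Z; split => //; rewrite -lee_fin -mE.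
have exB n : exists B, [/\ measurable B, A `<=` B & m B <= inf X + n.+1%:R^-1].
  have [|_ [B [mB AB] <-] Be] := @inf_adherent _ X (n.+1%:R^-1) _ hX.
    by rewrite invr_gt0.
  by exists B; split => //; exact: ltW.
have [Z ZP] := choice exZ; have [B BP] := choice exB.
have mZ n : measurable (Z n) by have [] := ZP n.
have mB n : measurable (B n) by have [] := BP n.
pose ZZ := \bigcup_n Z n; pose BB := \bigcap_n B n.
have mZZ : measurable ZZ by exact: bigcupT_measurable.
have mBB : measurable BB by exact: bigcap_measurableType.
have ZZA : ZZ `<=` A by move=> x [n _]; have [_ + _] := ZP n; apply.
have ABB : A `<=` BB by move=> x Ax n _; have [_ + _] := BP n; apply.
rewrite -(setDUK ZZA); apply: measurableU => //; apply: compl.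
exists (BB `\` ZZ); split; [exact: measurableD| |exact: setSD].
apply/le_anti; rewrite measure_ge0 andbT.
have mD : measurable (BB `\` ZZ) by exact: measurableD.
rewrite mE// lee_fin; apply/ler_addgt0Pr => e e0; rewrite add0r.
pose n := Num.truncn (e / 2)^-1.
have ne : n.+1%:R^-1 < e / 2.
  by rewrite invf_plt ?posrE ?divr_gt0// truncnS_gt.
have [_ ZnA Zn] := ZP n; have [_ ABn Bn] := BP n.
have ZBn : Z n `<=` B n by exact: subset_trans ABn.
have h1 : m (BB `\` ZZ) <= m (B n `\` Z n).
  rewrite -lee_fin -!mE//; last exact: measurableD.
  apply: le_measure; rewrite ?inE//; first exact: measurableD.
  by move=> x [Bx Zx]; split; [exact: Bx|move=> Znx; apply: Zx; exists n].
have h2 : m (B n `\` Z n) = m (B n) - m (Z n).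
  have : mu (B n) = (mu (Z n) + mu (B n `\` Z n))%E.
    by rewrite -measureU ?setDIK// ?setDUK//; exact: measurableD.
  rewrite !mE//; last exact: measurableD.
  by case=> ->; rewrite addrAC subrr add0r.
move: (n.+1%:R^-1) ne Zn Bn => q ne Zn Bn; lra.
Qed.

End outer_continuity.

(** * Suslin schemes and capacitability *)

Section suslin_schemes.
Context {disp : measure_display} {T : measurableType disp} {R : realType}.
Context {E : pointedType} (F : set E) (delta : E -> E -> R).
Hypothesis pm : proper_pmetric F delta.

(** With [aw N ctr] for [delta] this unfolds to [aw_open_in], which links it to the measurability in
    [random_lsc]. *)
Definition pm_open : set (set E) := [set U | U `<=` F /\ forall f, U f ->
  exists2 r : R, 0 < r & forall g, F g -> delta f g < r -> U g].

Definition pm_closed (K : set E) : Prop := K `<=` F /\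
  forall f, F f -> (forall e : R, 0 < e -> exists2 g, K g & delta f g < e) -> K f.

(** Closed and bounded, which [pm_proper] turns into compactness. [F c] stands under [K g] so that
    the empty set qualifies even if F is empty. *)
Definition pm_compact (K : set E) : Prop := pm_closed K /\
  exists c M, forall g, K g -> F c /\ delta c g <= M.

(* Levels m of the scheme are indexed by infinite sequences s, of which only
   s 0, ..., s m matter. *)
Definition suslin (A : set (T * E)) : Prop :=
  exists (B : nat -> (nat -> nat) -> set T) (K : nat -> (nat -> nat) -> set E),
  [/\ forall m s, measurable (B m s), forall m s, pm_compact (K m s),
      forall m s t, (forall i, (i <= m)%N -> s i = t i) -> B m s = B m t /\ K m s = K m t &
      A = [set p | exists s, forall m, B m s p.1 /\ K m s p.2]].

Lemma suslin_rect (B : set T) (K : set E) : measurable B -> pm_compact K -> suslin (B `*` K).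
Proof.
move=> mB cK; exists (fun _ _ => B), (fun _ _ => K); split => //.
apply/seteqP; split => [[x f] [/= Bx Kf]|[x f] [s /(_ 0%N)//]].
by exists (fun=> 0%N).
Qed.

Lemma suslin_data (A : nat -> set (T * E)) : (forall n, suslin (A n)) ->
  exists (B : nat -> nat -> (nat -> nat) -> set T) (K : nat -> nat -> (nat -> nat) -> set E),
  forall n, [/\ forall m s, measurable (B n m s), forall m s, pm_compact (K n m s),
      forall m s t, (forall i, (i <= m)%N -> s i = t i) ->
        B n m s = B n m t /\ K n m s = K n m t &
      A n = [set p | exists s, forall m, B n m s p.1 /\ K n m s p.2]].
Proof. by move=> /choice[B /choice[K h]]; exists B, K. Qed.

Lemma suslin_bigcup (A : nat -> set (T * E)) : (forall n, suslin (A n)) ->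
  suslin (\bigcup_n A n).
Proof.
move=> /suslin_data[B [K BK]].
(* The entry [s 0] codes the index of the set together with the first entry of its sequence, so
   level m still depends on [s 0], ..., [s m] only. *)
pose i (s : nat -> nat) := (Cantor.of_nat (s 0%N)).1.
pose s' (s : nat -> nat) j := if j is 0%N then (Cantor.of_nat (s 0%N)).2 else s j.
exists (fun m s => B (i s) m (s' s)), (fun m s => K (i s) m (s' s)); split.
- by move=> m s; have [] := BK (i s).
- by move=> m s; have [] := BK (i s).
- move=> m s t st; have -> : i s = i t by rewrite /i st.
  have [_ _ + _] := BK (i t); apply => -[_|j jm]; first by rewrite /s' st.
  by rewrite /s' st.
apply/seteqP; split => [p [n _]|p [s sP]].
  have [_ _ _ ->] := BK n => -[s sP].
  exists (fun j => if j is 0%N then Cantor.to_nat (n, s 0%N) else s j) => m.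
  have -> : s' (fun j => if j is 0%N then Cantor.to_nat (n, s 0%N) else s j) = s.
    by apply/funext => -[|j]; rewrite /s' ?Cantor.cancel_of_to.
  by rewrite /i Cantor.cancel_of_to.
by exists (i s) => //; have [_ _ _ ->] := BK (i s); exists (s' s).
Qed.

(** Hence in a coded family of sequences all entries (i, j) with j <= m are available at level (i,
    m). *)
Lemma Cantor_to_nat_leq i j m : (j <= m)%N -> (Cantor.to_nat (i, j) <= Cantor.to_nat (i, m))%N.
Proof.
move=> jm; have := Cantor.to_nat_spec i j; have := Cantor.to_nat_spec i m.
nia.
Qed.

(** A point of the intersection needs one sequence for each set; Cantor pairing packs them into a
    single s, and level m of the new scheme tests level [l m] of scheme [i m]. *)
Lemma suslin_bigcap (A : nat -> set (T * E)) : (forall n, suslin (A n)) ->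
  suslin (\bigcap_n A n).
Proof.
move=> /suslin_data[B [K BK]].
pose i n := (Cantor.of_nat n).1; pose l n := (Cantor.of_nat n).2.
pose sub (s : nat -> nat) k j := s (Cantor.to_nat (k, j)).
exists (fun n s => B (i n) (l n) (sub s (i n))), (fun n s => K (i n) (l n) (sub s (i n))); split.
- by move=> m s; have [] := BK (i m).
- by move=> m s; have [] := BK (i m).
- move=> m s t st; have [_ _ + _] := BK (i m); apply => j jm; apply: st.
  apply: leq_trans (Cantor_to_nat_leq (i m) jm) _.
  by rewrite /i /l -surjective_pairing Cantor.cancel_to_of.
apply/seteqP; split => [p Ap|p [s sP] n _].
  have ex n : exists s : nat -> nat, forall m, B n m s p.1 /\ K n m s p.2.
    by have := Ap n I; have [_ _ _ ->] := BK n.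
  have [s sP] := choice ex.
  exists (fun n => s (i n) (l n)) => m.
  have -> : sub (fun n => s (i n) (l n)) (i m) = s (i m).
    by apply/funext => j; rewrite /sub /i /l !Cantor.cancel_of_to.
  exact: sP.
have [_ _ _ ->] := BK n; exists (sub s n) => m.
by have := sP (Cantor.to_nat (n, m)); rewrite /i /l Cantor.cancel_of_to.
Qed.

Lemma suslin_set0 : suslin set0.
Proof.
rewrite -(@setX0 T E setT); apply: suslin_rect => //.
by split; [split => // f _ /(_ 1 ltr01)[]|exists point, 0].
Qed.

(** F is the union of countably many bounded balls about one of its points. *)
Lemma suslin_rect_closed (B : set T) (K : set E) : measurable B -> pm_closed K ->
  suslin (B `*` K).
Proof.
move=> mB [KF Kcl]; have [[c Fc]|nF] := pselect (exists c, F c); last first.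
  have -> : K = set0 by rewrite -subset0 => f /KF Ff; case: nF; exists f.
  by rewrite setX0; exact: suslin_set0.
have -> : B `*` K = \bigcup_n (B `*` (K `&` [set f | delta c f <= n%:R])).
  apply/seteqP; split => [[x f] [/= Bx Kf]|[x f] [n _ [/= Bx [Kf _]]] //].
  exists (Num.truncn (delta c f)).+1 => //; split => //; split => //=.
  by rewrite ltW// truncnS_gt.
apply: suslin_bigcup => n; apply: suslin_rect => //; split; last first.
  by exists c, n%:R => g [].
split => [f [/KF]//|f Ff lim]; split.
  by apply: Kcl => // e /lim[g [Kg _] ?]; exists g.
apply/ler_addgt0Pr => e /lim[g [Kg /= cg] fg].
have := pm_triangle pm Fc (KF _ Kg) Ff; rewrite (pm_sym pm (KF _ Kg) Ff).
lra.
Qed.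

(** An open set is the union of the closed sets [K n] of points at distance at least 1/(n+1) from
    its complement. *)
Lemma suslin_pm_open (B : set T) (U : set E) : measurable B -> pm_open U ->
  suslin (B `*` U) /\ suslin (B `*` (F `\` U)).
Proof.
move=> mB [UF Uop]; split; last first.
  apply: suslin_rect_closed => //; split => [f []//|f Ff lim]; split => // Uf.
  have [r r0 rU] := Uop _ Uf; have [g [Fg Ug] fg] := lim r r0.
  by apply: Ug; exact: rU.
pose K n := [set f | F f /\ forall g, F g -> ~ U g -> n.+1%:R^-1 <= delta f g].
have -> : B `*` U = \bigcup_n (B `*` K n).
  apply/seteqP; split => [[x f] [/= Bx Uf]|[x f] [n _ [/= Bx [Ff Kf]]]].
    have [r r0 rU] := Uop _ Uf; exists (Num.truncn r^-1) => //; split => //; split; first exact: UF.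
    move=> g Fg Ug; rewrite leNgt; apply/negP => fg; apply: Ug; apply: rU => //.
    by apply: lt_trans fg _; rewrite invf_plt ?posrE// truncnS_gt.
  split => //=; apply: contrapT => Uf; have := Kf f Ff Uf.
  by rewrite (pm_refl pm Ff) leNgt invr_gt0 ltr0Sn.
apply: suslin_bigcup => n; apply: suslin_rect_closed => //; split => [f []//|f Ff lim].
split => // g Fg Ug; apply/ler_addgt0Pr => e /lim[h [Fh hK] fh].
have := pm_triangle pm Fh Ff Fg; have := hK g Fg Ug; rewrite (pm_sym pm Fh Ff).
by move: (n.+1%:R^-1) => q; lra.
Qed.

(** The Suslin operation does not respect complements, so the induction carries A and its complement
    together; such sets form a sigma-algebra containing the generating cylinders. *)
Lemma suslin_measurable (A : set (T * g_sigma_algebraType pm_open)) : measurable A ->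
  suslin (A `&` setT `*` F).
Proof.
have pmF : pm_closed F by split.
pose C (A : set (T * E)) := suslin (A `&` setT `*` F) /\ suslin (~` A `&` setT `*` F).
have CU (A' : nat -> set (T * E)) : (forall n, C (A' n)) -> C (\bigcup_n A' n).
  move=> CA; split; first by rewrite setI_bigcupl; apply: suslin_bigcup => n; case: (CA n).
  rewrite setC_bigcup setIC -bigcapIr; last by exists 0%N.
  by apply: suslin_bigcap => n; rewrite setIC; case: (CA n).
have C0 : C set0.
  split; first by rewrite set0I; exact: suslin_set0.
  rewrite setC0 setTI; exact: suslin_rect_closed pmF.
have CC (A' : set (T * E)) : C A' -> C (~` A') by case=> ? ?; split => //; rewrite setCK.
move=> mA; suff [] : C A by [].
apply: (mA C); split.
  by split => // A' /CC; rewrite setTD.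
move=> _ [[B mB <-]|[U mU <-]].
  rewrite setTI /C.
  have -> : fst @^-1` B `&` setT `*` F = B `*` F by apply/seteqP; split => -[x f] /= [] // ? [].
  have -> : ~` (fst @^-1` B) `&` setT `*` F = (~` B) `*` F.
    by apply/seteqP; split => -[x f] /= [] // ? [].
  by split; apply: suslin_rect_closed pmF => //; exact: measurableC.
rewrite setTI; apply: (mU (fun V => C (snd @^-1` V))); split.
  split; first exact: C0.
    by move=> V; rewrite setTD; exact: CC.
  by move=> V CV; rewrite preimage_bigcup; exact: CU.
move=> V Vop; have [s1 s2] := suslin_pm_open measurableT Vop; split.
  rewrite (_ : _ `&` _ = setT `*` V)//; apply/seteqP; split => -[x f] /= [] //.
  by move=> _ Vf; split => //; split => //; case: Vop => VF _; exact: VF.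
rewrite (_ : _ `&` _ = setT `*` (F `\` V))//.
by apply/seteqP; split => -[x f] /= [] // ? [].
Qed.

Variable mu : {finite_measure set T -> \bar R}.

(** Bounding the entries of s by [N 0], [N 1], ... in turn loses arbitrarily little outer measure.
    Sequences bounded by N form a compact set, so the measurable sets [Z N k], which test k levels
    only, decrease to a subset of the projection. *)
Lemma suslin_projection_inner (A : set (T * E)) (a b : R) : suslin A -> a < b ->
  outer_ge mu b (fst @` A) ->
  exists Z, [/\ measurable Z, Z `<=` fst @` A & (a%:E <= mu Z)%E].
Proof.
move=> [B [K [mB cK dep ->]]] ab bA.
pose A' (N : nat -> nat) k := [set x | exists s, (forall i, (i < k)%N -> (s i <= N i)%N) /\
  exists f, forall m, B m s x /\ K m s f].
pose Z (N : nat -> nat) k := [set x | exists s, (forall i, (i < k)%N -> (s i <= N i)%N) /\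
  exists f, forall m, (m < k)%N -> B m s x /\ K m s f].
have AZ N k : A' N k `<=` Z N k by move=> x [s [sN [f sf]]]; exists s; split => //; exists f.
(* Only k entries of s matter, so this is a countable union over lists l; whether a suitable f
   exists does not depend on x. *)
have mZ N k : measurable (Z N k).
  pose q (l : seq nat) i := nth 0%N l i.
  pose W (l : seq nat) := if pselect ((forall i, (i < k)%N -> (q l i <= N i)%N) /\
      exists f, forall m, (m < k)%N -> K m (q l) f)
    then \bigcap_(m in [set m | (m < k)%N]) B m (q l) else set0.
  have -> : Z N k = \bigcup_l W l.
    apply/seteqP; split => [x [s [sN [f sf]]]|x [l _]].
      have qs m : (m < k)%N -> q (mkseq s k) m = s m by move=> mk; rewrite /q nth_mkseq.
      have dq m : (m < k)%N -> B m (q (mkseq s k)) = B m s /\ K m (q (mkseq s k)) = K m s.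
        by move=> mk; apply: dep => i im; apply: qs; exact: leq_ltn_trans mk.
      exists (mkseq s k) => //; rewrite /W; case: pselect => [_ m /= mk|[]].
        by have [-> _] := dq m mk; case: (sf m mk).
      split => [i ik|]; first by rewrite qs// sN.
      by exists f => m mk; have [_ ->] := dq m mk; case: (sf m mk).
    rewrite /W; case: pselect => // h Bx; have [lN [f lf]] := h; exists (q l); split => //.
    by exists f => m mk; split; [exact: Bx|exact: lf].
  apply: countable_bigcupT_measurable; first exact: countableP.
  move=> l; rewrite /W; case: pselect => /= [h|h]; last exact: measurable0.
  by apply: bigcap_measurableType => m _; exact: mB.
(* [c 0] is b and all [c k] are at least a: the choice of the k-th bound may cost [c k - c k.+1]. *)
pose c k : R := a + (b - a) / k.+1%:R.
have cS k : c k.+1 < c k.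
  by rewrite /c ltrD2l ltr_pM2l ?subr_gt0// ltf_pV2 ?posrE// ltr_nat.
have ac k : a <= c k by rewrite /c lerDl divr_ge0// subr_ge0 ltW.
have step (k : nat) (l : seq nat) : exists j, size l = k ->
    outer_ge mu (c k) (A' (nth 0%N l) k) -> outer_ge mu (c k.+1) (A' (nth 0%N (rcons l j)) k.+1).
  have [[sl h]|nh] := pselect (size l = k /\ outer_ge mu (c k) (A' (nth 0%N l) k)); last first.
    by exists 0%N => sl h; case: nh.
  have [||j jP] := @outer_ge_bigcup _ _ _ mu (fun j => A' (nth 0%N (rcons l j)) k.+1) (c k.+1) (c k) _ (cS k).
  - move=> n m nm x [s [sN sf]]; exists s; split => // i ik.
    apply: leq_trans (sN i ik) _; rewrite !nth_rcons; case: ltnP => // _.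
    by case: eqP.
  - move=> C mC subC; apply: h => // x [s [sN sf]]; apply: subC; exists (s k) => //.
    exists s; split => // i; rewrite ltnS leq_eqVlt nth_rcons sl => /predU1P[->|ik].
      by rewrite ltnn eqxx.
    by rewrite ik sN.
  by exists j.
have [next nextP] := choice (fun l => step (size l) l).
pose L := fix L n : seq nat := if n is m.+1 then rcons (L m) (next (L m)) else [::].
have sL n : size (L n) = n by elim: n => //= n IH; rewrite size_rcons IH.
pose N i := next (L i).
have LN n i : (i < n)%N -> nth 0%N (L n) i = N i.
  elim: n => // n IH; rewrite ltnS leq_eqVlt /= nth_rcons sL => /predU1P[->|ik].
    by rewrite ltnn eqxx.
  by rewrite ik IH.
have big n : outer_ge mu (c n) (A' (nth 0%N (L n)) n).
  elim: n => [|n IH]; last by have := nextP (L n); rewrite sL; apply.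
  rewrite /c divr1 subrKC => C mC subC; apply: bA => // _ [p [s sP] <-].
  by apply: subC; exists s; split => //; exists p.2.
have Zmu n : (a%:E <= mu (Z N n))%E.
  apply: (@le_trans _ _ (c n)%:E); first by rewrite lee_fin.
  apply: big => // x [s [sN [f sf]]]; apply: AZ; exists s; split; last by exists f.
  by move=> i ik; rewrite -(LN n)// sN.
have homZ : {homo Z N : n m / (n <= m)%N >-> (m <= n)%O}.
  move=> n m nm; apply/subsetPset => x [s [sN [f sf]]]; exists s.
  by split => [i /leq_trans/(_ nm)|]; [exact: sN|exists f => i /leq_trans/(_ nm); exact: sf].
exists (\bigcap_n Z N n).
have mZZ : measurable (\bigcap_n Z N n) by exact: bigcap_measurableType.
split => //; last first.
  have fin0 : (mu (Z N 0%N) < +oo)%E by rewrite ltey_eq fin_num_measure.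
  have lim := nonincreasing_cvg_mu (mu := mu) fin0 (mZ N) mZZ homZ.
  rewrite -(cvg_lim _ lim)//; apply: lime_ge; first by apply/cvg_ex; eexists; exact: lim.
  by apply: nearW => n /=.
(* Koenig's lemma for s and compactness for f, along the same ultrafilter *)
move=> x Zx.
have ex n : exists sf : (nat -> nat) * E, (forall i, (i < n)%N -> (sf.1 i <= N i)%N) /\
    forall m, (m < n)%N -> B m sf.1 x /\ K m sf.1 sf.2.
  by have [s [sN [f sf]]] := Zx n I; exists (s, f).
have [u uP] := choice ex.
have [U [UU ooU]] := ultraFilterLemma (eventually_filter : ProperFilter \oo).
have Ugt i : U [set n | (i < n)%N] by apply: ooU; exists i.+1.
have Uval (g : nat -> nat) M : U [set n | (g n <= M)%N] -> exists v, U [set n | g n = v].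
  elim: M => [|M IH] h; first by exists 0%N; apply: filterS h => n /=; rewrite leqn0 => /eqP.
  have [h1|h1] := in_ultra_setVsetC [set n | g n = M.+1] UU; first by exists M.+1.
  apply: IH; apply: filterS (filterI h h1) => n /= [+ /eqP].
  by rewrite leq_eqVlt ltnS => /orP[->|].
have exv i : exists v, U [set n | (u n).1 i = v].
  by apply: (Uval _ (N i)); apply: filterS (Ugt i) => n /= ik; apply: (proj1 (uP n)).
have [s sP] := choice exv.
have Us m : U [set n | forall i, (i <= m)%N -> (u n).1 i = s i].
  elim: m => [|m IH].
    by apply: filterS (sP 0%N) => n /= h i; rewrite leqn0 => /eqP ->.
  apply: filterS (filterI IH (sP m.+1)) => n /= [h1 h2] i.
  by rewrite leq_eqVlt => /predU1P[->|/h1].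
have UBK m : U [set n | B m s x /\ K m s (u n).2].
  apply: filterS (filterI (Us m) (Ugt m)) => n /= [h mn].
  have [Bx Kf] := proj2 (uP n) m mn.
  by have [<- <-] := dep m _ _ h.
have [[KF0 _] [c0 [M cM]]] := cK 0%N s.
have [n0 [_ Kn0]] := filter_ex (UBK 0%N).
have [Fc _] := cM _ Kn0.
have [|f Ff uf] := pm_proper pm UU ooU (u := fun n => (u n).2) (M := M) Fc.
  by apply: filterS (UBK 0%N) => n [_ /[dup] /KF0 ? /cM[]].
exists (x, f) => //; exists s => m; have [n1 [Bx _]] := filter_ex (UBK m).
split => //=; have [[KF Kcl] _] := cK m s; apply: Kcl => // e e0.
have [n [[_ Kn] un]] := filter_ex (filterI (UBK m) (uf e e0)).
by exists (u n).2 => //; rewrite (pm_sym pm Ff (KF _ Kn)).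
Qed.

Lemma measurable_projection (A : set (T * g_sigma_algebraType pm_open)) :
  measure_is_complete mu -> measurable A -> measurable (fst @` (A `&` setT `*` F)).
Proof.
move=> compl mA; apply: (complete_measurable compl) => a b ab.
exact: suslin_projection_inner (suslin_measurable mA) ab.
Qed.

End suslin_schemes.

(** * The strong law of large numbers *)

(** For L 2^n <= k < 2 L 2^n the quotient p of k by 2^n lies in [L, 2 L), and monotonicity encloses
    [s k] between the values at p 2^n and (p + 1) 2^n, whose arguments have ratio at most 1 + 1 /
    L. *)
Lemma cvg_dyadic_interpolation {R : realType} (s : nat -> R) (m : R) :
  {homo s : i j / (i <= j)%N >-> i <= j} -> 0 <= m ->
  (forall p, (0 < p)%N -> s (p * 2 ^ n)%N / (p * 2 ^ n)%:R @[n --> \oo] --> m) ->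
  s n / n%:R @[n --> \oo] --> m.
Proof.
move=> homs m0 sp; apply/cvgrPdist_lt => e e0.
pose e' := Num.min (e / 3) 1.
have e'0 : 0 < e' by rewrite /e' lt_min ltr01 andbT; lra.
have e'1 : e' <= 1 by rewrite /e' ge_min lexx orbT.
have e'e : e' <= e / 3 by rewrite /e' ge_min lexx.
(* Since 2^n <= k / L, rounding k to a multiple of 2^n costs less than e / 3. *)
pose L := (Num.truncn (3 * (m + 1) / e)).+1.
have Le : (m + 1) / L%:R < e / 3.
  have h : 3 * (m + 1) / e < L%:R by exact: truncnS_gt.
  rewrite ltr_pdivrMr ?ltr0n//; move: h; rewrite ltr_pdivrMr//; lra.
have L0 : 0 < L%:R :> R by rewrite ltr0n.
have unif M : exists n0, forall p n, (0 < p <= M)%N -> (n0 <= n)%N ->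
    `|m - s (p * 2 ^ n)%N / (p * 2 ^ n)%:R| < e'.
  elim: M => [|M [n0 n0P]]; first by exists 0%N => -[].
  have /cvgrPdist_lt /(_ e' e'0)[n1 _ n1P] := sp M.+1 (ltn0Sn M).
  exists (maxn n0 n1) => p n /andP[p0]; rewrite leq_eqVlt ltnS geq_max => /predU1P[->|pM] /andP[? ?].
    exact: n1P.
  by apply: n0P; rewrite ?p0.
have [n0 n0P] := unif (2 * L)%N.
exists (L * 2 ^ n0)%N => // k /= kL.
have k0 : (0 < k)%N by apply: leq_trans kL; rewrite muln_gt0 expn_gt0.
pose n := trunc_log 2 (k %/ L).
have kL0 : (0 < k %/ L)%N.
  by rewrite divn_gt0//; apply: leq_trans kL; rewrite leq_pmulr// expn_gt0.
have nk : (L * 2 ^ n <= k)%N.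
  have := trunc_logP (isT : (1 < 2)%N) kL0; rewrite -/n => h.
  by apply: leq_trans (leq_divM k L); rewrite mulnC leq_mul2r h orbT.
have kn : (k < L * 2 ^ n.+1)%N.
  have := trunc_log_ltn (k %/ L) (isT : (1 < 2)%N); rewrite -/n.
  by rewrite ltn_divLR// mulnC.
have n0n : (n0 <= n)%N.
  have := leq_ltn_trans kL kn; rewrite ltn_pmul2l// ltn_exp2l//.
pose p := (k %/ 2 ^ n)%N.
have e2n : (0 < 2 ^ n)%N by rewrite expn_gt0.
have Lp : (L <= p)%N by rewrite /p leq_divRL.
have p0 : (0 < p)%N by exact: leq_trans Lp.
have pL : (p < 2 * L)%N by rewrite /p ltn_divLR// (leq_trans kn)// expnS mulnA [(L * 2)%N]mulnC.
have pk : (p * 2 ^ n <= k)%N by exact: leq_divM.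
have kp : (k < p.+1 * 2 ^ n)%N by rewrite /p ltn_ceil.
have h1 := n0P p n; rewrite p0 (ltnW pL) in h1; have {}h1 := h1 isT n0n.
have h2 := n0P p.+1 n; rewrite pL in h2; have {}h2 := h2 isT n0n.
move: h1 h2; rewrite !ltr_norml => /andP[_ h1] /andP[h2 _].
have pR : 0 < p%:R :> R by rewrite ltr0n.
have tR : 0 < (2 ^ n)%:R :> R by rewrite ltr0n.
have LpR : L%:R <= p%:R :> R by rewrite ler_nat.
have kR : 0 < k%:R :> R by rewrite ltr0n.
have pkR : p%:R * (2 ^ n)%:R <= k%:R :> R by rewrite -natrM ler_nat.
have kpR : k%:R <= (p%:R + 1) * (2 ^ n)%:R :> R by rewrite natr1 -natrM ler_nat ltnW.
have s1 : (m - e') * (p%:R * (2 ^ n)%:R) <= s k.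
  apply: le_trans (homs _ _ pk).
  by rewrite -ler_pdivlMr ?mulr_gt0// -natrM ltW//; lra.
have s2 : s k <= (m + e') * ((p%:R + 1) * (2 ^ n)%:R).
  apply: le_trans (homs _ _ (ltnW kp)) _.
  rewrite natr1 -natrM -ler_pdivrMr; last by rewrite ltr0n muln_gt0.
  by move: h2; rewrite ltrNl opprB ltrBlDl => /ltW.
have Lm : (m + 1) * (2 ^ n)%:R <= e / 3 * k%:R.
  have h : (m + 1) <= e / 3 * L%:R by rewrite -ler_pdivrMr// ltW.
  have h' : L%:R * (2 ^ n)%:R <= k%:R :> R by rewrite -natrM ler_nat.
  apply: le_trans (ler_wpM2r (ltW tR) h) _.
  have e3 : 0 <= e / 3 by lra.
  by have := ler_wpM2l e3 h'; rewrite mulrA.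
have mt : (m + e') * (2 ^ n)%:R <= (m + 1) * (2 ^ n)%:R by rewrite ler_wpM2r ?(ltW tR)//; lra.
have e'k : e' * k%:R <= e / 3 * k%:R by rewrite ler_wpM2r ?(ltW kR).
have u1 : (m + e') * (p%:R * (2 ^ n)%:R) <= (m + e') * k%:R by rewrite ler_wpM2l//; lra.
have u2 : m * (k%:R - (2 ^ n)%:R) <= m * (p%:R * (2 ^ n)%:R) by rewrite ler_wpM2l//; lra.
have u3 : e' * (p%:R * (2 ^ n)%:R) <= e' * k%:R by rewrite ler_wpM2l// ltW.
have u4 : 0 <= (2 ^ n)%:R :> R by rewrite ltW.
have u5 : 0 < e * k%:R by rewrite mulr_gt0.
apply/andP; split.
  rewrite ltrNl opprB ltrBlDl ltr_pdivrMr// mulrDl.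
  apply: le_lt_trans s2 _; nra.
rewrite ltrBlDr -ltrBlDl ltr_pdivlMr// mulrBl.
apply: lt_le_trans s1; nra.
Qed.

(* The dyadic sum splits at 2^n p ~ z; the conjunction is the invariant that
   carries both geometric sums through the induction. *)
Lemma sum_truncated_sqr {R : realType} (z : R) (p K : nat) : 0 <= z -> (0 < p)%N ->
  \sum_(n < K) Num.min z (p * 2 ^ n)%:R ^+ 2 / (p * 2 ^ n)%:R <= 4 * z.
Proof.
move=> z0 p0; pose k n : R := (p * 2 ^ n)%:R.
have k0 n : 0 < k n by rewrite ltr0n muln_gt0 p0 expn_gt0.
have kS n : k n.+1 = 2 * k n by rewrite /k expnS mulnCA natrM.
have z2 n : z < k n -> 0 <= z ^+ 2 / k n /\ z ^+ 2 / k n <= z.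
  move=> zk; rewrite ler_pdivrMr// divr_ge0 ?sqr_ge0// ?(ltW (k0 n))//; split => //.
  by rewrite expr2 ler_wpM2l// ltW.
suff [h1 h2] : (k K <= z -> \sum_(n < K) Num.min z (k n) ^+ 2 / k n <= k K) /\
     (z < k K -> \sum_(n < K) Num.min z (k n) ^+ 2 / k n <= 4 * z - 2 * (z ^+ 2 / k K)).
  have [kz|kz] := leP (k K) z; first by apply: le_trans (h1 kz) _; lra.
  by apply: le_trans (h2 kz) _; have [] := z2 K kz; lra.
elim: K => [|K [h1 h2]].
  rewrite big_ord0; split => [_|zk]; first exact: ltW.
  by have [] := z2 0%N zk; lra.
rewrite big_ord_recr/= kS; have kK := k0 K.
have [kz|kz] := leP (k K) z.
  have {}h1 := h1 kz; rewrite expr2 mulfK ?gt_eqF//; split => [kz'|kz']; first lra.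
  have : z ^+ 2 / (2 * k K) <= (3 * z - 2 * k K) / 2 + k K / 2.
    rewrite ler_pdivrMr ?mulr_gt0//; nra.
  lra.
have [zz1 zz2] := z2 K kz; split => kz'; first by have {}h2 := h2 kz; lra.
have {}h2 := h2 kz.
have -> : z ^+ 2 / (2 * k K) = (z ^+ 2 / k K) / 2 by rewrite invfM mulrA mulrAC.
lra.
Qed.

(** The series has a finite integral, so it converges almost everywhere and its terms vanish. This
    takes the place of Chebyshev's inequality and Borel-Cantelli. *)
Lemma ae_nneseries_cvg0 {d} {T : measurableType d} {R : realType}
    (mu : {measure set T -> \bar R}) (g : nat -> T -> R) :
  (forall n x, 0 <= g n x) -> (forall n, measurable_fun setT (g n)) ->
  (\sum_(0 <= n <oo) \int[mu]_x (g n x)%:E < +oo)%E ->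
  {ae mu, forall x, g n x @[n --> \oo] --> (0 : R)}.
Proof.
move=> g0 mg; rewrite -integral_nneseries//; last 2 first.
- by move=> n; apply/measurable_EFinP.
- by move=> n x _; rewrite lee_fin.
move=> fin.
have int : mu.-integrable setT (fun x => \sum_(0 <= n <oo) (g n x)%:E)%E.
  apply/integrableP; split.
    apply: ge0_emeasurable_sum => [n x _ _|n _]; first by rewrite lee_fin.
    by apply/measurable_EFinP.
  apply: le_lt_trans fin; apply: ge0_le_integral => //.
  - apply: measurableT_comp => //.
    apply: ge0_emeasurable_sum => [n x _ _|n _]; first by rewrite lee_fin.
    by apply/measurable_EFinP.
  - apply: ge0_emeasurable_sum => [n x _ _|n _]; first by rewrite lee_fin.
    by apply/measurable_EFinP.
  - by move=> x _; rewrite gee0_abs//; apply: nneseries_ge0 => n _ _; rewrite lee_fin.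
have := integrable_ae measurableT int.
apply: filterS => x /(_ I) fx; apply: cvg_series_cvg_0.
apply: nondecreasing_is_cvgn.
  by apply/nondecreasing_seqP => n; rewrite /series/= big_nat_recr//= lerDl.
exists (fine (\sum_(0 <= n <oo) (g n x)%:E)%E) => _ [n _ <-].
rewrite -lee_fin fineK// /series/= -sumEFin.
by apply: nneseries_lim_ge => i _ _; rewrite lee_fin.
Qed.

(** * Etemadi's argument for iid samples *)

Section law_of_large_numbers.
Context {R : realType} {dO : measure_display} {Omega : measurableType dO}.
Variable P : probability Omega R.
Context {d0 : measure_display} {T0 : measurableType d0}.
Variable X : nat -> {mfun Omega >-> T0}.
Hypothesis X_iid : iid P X.
Local Notation mu := (distribution P (X 0%N)).

Lemma iid_preimage j (A : set T0) : measurable A -> P (X j @^-1` A) = mu A.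
Proof. by move=> mA; have := proj2 X_iid j A mA. Qed.

Lemma iid_integral j (f : T0 -> \bar R) : measurable_fun setT f ->
  (forall x, 0 <= f x)%E -> (\int[P]_w f (X j w) = \int[mu]_x f x)%E.
Proof.
move=> mf f0; rewrite -(ge0_integral_distribution (X j) mf f0).
by apply: eq_measure_integral => A mA _; exact: (proj2 X_iid).
Qed.

Lemma iid_ae j (Q : T0 -> Prop) : {ae mu, forall x, Q x} -> {ae P, forall w, Q (X j w)}.
Proof.
move=> [A [mA A0 QA]]; exists (X j @^-1` A); split.
- exact: measurable_funPTI.
- by rewrite iid_preimage.
- by move=> w /= Qw; exact: QA.
Qed.

(** By independence on rectangles the joint law of [X i] and [X j] is the product measure; Tonelli
    does the rest. *)
Lemma iid_integralM i j (f g : T0 -> \bar R) : i != j ->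
  measurable_fun setT f -> measurable_fun setT g ->
  (forall x, 0 <= f x)%E -> (forall x, 0 <= g x)%E ->
  (\int[P]_w (f (X i w) * g (X j w)) = (\int[mu]_x f x) * (\int[mu]_x g x))%E.
Proof.
move=> ij mf mg f0 g0.
pose Y w := (X i w, X j w).
have mY : measurable_fun setT Y by apply: measurable_fun_pair.
pose h (p : T0 * T0) := (f p.1 * g p.2)%E.
have mh : measurable_fun setT h.
  by apply: emeasurable_funM; apply: measurableT_comp.
have h0 p : (0 <= h p)%E by rewrite mule_ge0.
have := ge0_integral_pushforward mY P measurableT mh (fun p _ => h0 p).
rewrite preimage_setT => <-.
rewrite (@eq_measure_integral _ _ _ _ (mu \x mu)%E); last first.
  move=> A mA _; apply/esym; apply: product_measure_unique => // {mA}A B mA mB.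
  have := proj1 X_iid [:: i; j] (fun k => if k == i then A else B).
  rewrite /= mem_seq1 ij => /(_ isT).
  rewrite !big_cons big_nil mule1 eqxx eq_sym (negbTE ij).
  rewrite !iid_preimage// => <-; last by move=> k; case: ifP.
  congr (P _); apply/seteqP; split => w /=.
    move=> [Aw Bw] k /=; rewrite !inE => /orP[]/eqP ->; rewrite ?eqxx//.
    by rewrite eq_sym (negbTE ij).
  move=> Xw; split; first by have := Xw i; rewrite /= inE !eqxx; apply.
  by have := Xw j; rewrite /= !inE eqxx orbT eq_sym (negbTE ij); apply.
rewrite fubini_tonelli1// /fubini_F /h/=.
under eq_integral do rewrite ge0_integralZl//.
by rewrite ge0_integralZr// integral_ge0.
Qed.

Lemma variance_mean (g : T0 -> R) (m : R) (k : nat) : (0 < k)%N ->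
  measurable_fun setT g -> (forall x, 0 <= g x) -> (\int[mu]_x (g x)%:E = m%:E)%E ->
  (\int[P]_w (((\sum_(j < k) g (X j w)) / k%:R - m) ^+ 2)%:E <=
   (k%:R^-1)%:E * \int[mu]_x (g x ^+ 2)%:E)%E.
Proof.
move=> k0 mg g0 gm.
have k0' : 0 < k%:R :> R by rewrite ltr0n.
have m0 : 0 <= m by rewrite -lee_fin -gm integral_ge0// => x _; rewrite lee_fin.
have mgX j : measurable_fun setT (fun w => g (X j w)) by exact: measurableT_comp.
pose W w := \sum_(j < k) g (X j w).
have mW : measurable_fun setT W by exact: measurable_sum.
have W0 w : 0 <= W w by exact: sumr_ge0.
have iW : (\int[P]_w (W w)%:E = (k%:R * m)%:E)%E.
  under eq_integral do rewrite /W -sumEFin.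
  rewrite ge0_integral_sum//; last 2 first.
  - by move=> j; apply/measurable_EFinP.
  - by move=> j w _; rewrite lee_fin.
  rewrite (eq_bigr (fun=> m%:E)); last first.
    move=> j _; rewrite -gm; apply: (@iid_integral j (EFin \o g)).
      exact/measurable_EFinP.
    by move=> x; rewrite lee_fin.
  by rewrite sumEFin sumr_const card_ord mulr_natl.
have iW2 : (\int[P]_w (W w ^+ 2)%:E <= k%:R%:E * \int[mu]_x (g x ^+ 2)%:E + (k%:R ^+ 2 * m ^+ 2)%:E)%E.
  have WE w : ((W w ^+ 2)%:E = \sum_(i < k) \sum_(j < k) (g (X i w))%:E * (g (X j w))%:E)%E.
    rewrite expr2 /W mulr_suml -sumEFin; apply: eq_bigr => i _.
    by rewrite mulr_sumr -sumEFin; apply: eq_bigr => j _; rewrite EFinM.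
  under eq_integral do rewrite WE.
  have mgg i j : measurable_fun setT (fun w => (g (X i w))%:E * (g (X j w))%:E)%E.
    by apply: emeasurable_funM; apply/measurable_EFinP.
  have gg0 i j w : (0 <= (g (X i w))%:E * (g (X j w))%:E)%E by rewrite mule_ge0 ?lee_fin.
  rewrite ge0_integral_sum//; last 2 first.
  - by move=> i; apply: emeasurable_sum.
  - by move=> i w _; apply: sume_ge0 => j _.
  set v := (\int[mu]_x (g x ^+ 2)%:E)%E.
  have v0 : (0 <= v)%E by apply: integral_ge0 => x _; rewrite lee_fin sqr_ge0.
  apply: (@le_trans _ _ (\sum_(i < k) (v + (k%:R * m ^+ 2)%:E))%E); last first.
    rewrite big_split/= sumEFin !sumr_const card_ord mule_natl.
    by rewrite -[_ * _ *+ k]mulr_natl mulrA -expr2.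
  apply: lee_sum => i _; rewrite ge0_integral_sum// (bigD1 i)//=.
  apply: leeD.
    rewrite (@iid_integral i (fun x => (g x)%:E * (g x)%:E)%E).
    - by rewrite (eq_integral (fun x => (g x ^+ 2)%:E))// => x _; rewrite expr2 EFinM.
    - by apply: emeasurable_funM; apply/measurable_EFinP.
    - by move=> x; rewrite mule_ge0// lee_fin.
  rewrite (eq_bigr (fun=> (m ^+ 2)%:E)); last first.
    move=> j ji; rewrite expr2 EFinM -{1}gm -gm.
    apply: (@iid_integralM i j (EFin \o g) (EFin \o g)).
    - by rewrite eq_sym.
    - exact/measurable_EFinP.
    - exact/measurable_EFinP.
    - by move=> x; rewrite lee_fin.
    - by move=> x; rewrite lee_fin.
  rewrite sumEFin lee_fin; apply: (@le_trans _ _ (\sum_(j < k) m ^+ 2)).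
    rewrite [leRHS](bigD1 i)//= lerDr sqr_ge0//.
  by rewrite sumr_const card_ord mulr_natl.
pose V w := (W w / k%:R - m) ^+ 2.
have mV : measurable_fun setT V.
  by apply: measurable_funX; apply: measurable_funB => //; apply: measurable_funM.
(* The expanded square, its negative term moved to the left, so that only nonnegative functions are
   integrated. *)
have id w : ((V w)%:E + (2 * m / k%:R)%:E * (W w)%:E =
    (k%:R ^- 2)%:E * (W w ^+ 2)%:E + (m ^+ 2)%:E)%E.
  rewrite -!EFinM -!EFinD; congr EFin; rewrite /V; field.
  by rewrite gt_eqF.
have : (\int[P]_w ((V w)%:E + (2 * m / k%:R)%:E * (W w)%:E) =
    \int[P]_w ((k%:R ^- 2)%:E * (W w ^+ 2)%:E + (m ^+ 2)%:E))%E.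
  by apply: eq_integral => w _; rewrite id.
have c0 : 0 <= 2 * m / k%:R by rewrite divr_ge0 ?mulr_ge0// ltW.
rewrite ge0_integralD//; last 4 first.
- by move=> w _; rewrite lee_fin sqr_ge0.
- exact/measurable_EFinP.
- by move=> w _; rewrite mule_ge0// lee_fin.
- by apply: emeasurable_funM => //; apply/measurable_EFinP.
rewrite [X in _ = X]ge0_integralD//; last 3 first.
- by move=> w _; rewrite mule_ge0// lee_fin ?invr_ge0 ?sqr_ge0// exprn_ge0// ltW.
- by apply: emeasurable_funM => //; apply/measurable_EFinP; apply: measurable_funX.
- by move=> w _; rewrite lee_fin sqr_ge0.
rewrite ge0_integralZl//; last 2 first.
- by apply/measurable_EFinP.
- by move=> w _; rewrite lee_fin.
rewrite ge0_integralZl//; last 2 first.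
- by apply/measurable_EFinP; apply: measurable_funX.
- by move=> w _; rewrite lee_fin sqr_ge0.
have -> : (\int[P]_w (m ^+ 2)%:E = (m ^+ 2)%:E)%E.
  rewrite (@integral_cst _ _ _ P setT measurableT (m ^+ 2)%:E).
  by transitivity ((m ^+ 2)%:E * 1)%E; [congr (_ * _)%E; exact: probability_setT|exact: mule1].
rewrite iW -EFinM.
have -> : 2 * m / k%:R * (k%:R * m) = 2 * m ^+ 2 by field; rewrite gt_eqF.
move=> h; rewrite -(@leeD2rE _ (2 * m ^+ 2)%:E)// h.
apply: (le_trans (leeD2r _ (lee_wpmul2l _ iW2))).
  by rewrite lee_fin invr_ge0 exprn_ge0// ltW.
rewrite ge0_muleDr//; last 2 first.
- by rewrite mule_ge0 ?lee_fin ?(ltW k0')// integral_ge0// => x _; rewrite lee_fin sqr_ge0.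
- by rewrite lee_fin mulr_ge0 ?sqr_ge0.
rewrite muleA -!EFinM -addeA -EFinD.
have -> : k%:R ^- 2 * k%:R = k%:R^-1 :> R by field; rewrite gt_eqF.
have -> : k%:R ^- 2 * (k%:R ^+ 2 * m ^+ 2) + m ^+ 2 = 2 * m ^+ 2 by field; rewrite gt_eqF.
by [].
Qed.

(** Values are cut at the block length [k n]. The squared deviation [V n] of the truncated mean and
    the number [U n] of samples cut have expectations at most that of [q n], and the [q n] sum to at
    most 4 Z; so both vanish almost surely. *)
Lemma slln_dyadic (Z : T0 -> R) (p : nat) : (0 < p)%N -> measurable_fun setT Z ->
  (forall x, 0 <= Z x) -> (\int[mu]_x (Z x)%:E < +oo)%E ->
  {ae P, forall w, (\sum_(j < p * 2 ^ n) Z (X j w)) / (p * 2 ^ n)%:R @[n --> \oo]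
    --> fine (\int[mu]_x (Z x)%:E)%E}.
Proof.
move=> p0 mZ Z0 Zoo.
pose k n := (p * 2 ^ n)%N.
have k0 n : (0 < k n)%N by rewrite muln_gt0 p0 expn_gt0.
have kR n : 0 < (k n)%:R :> R by rewrite ltr0n.
pose g n x : R := Num.min (Z x) (k n)%:R.
have g0 n x : 0 <= g n x by rewrite le_min Z0 ltW.
have gZ n x : g n x <= Z x by rewrite ge_min lexx.
have mg n : measurable_fun setT (g n) by exact: measurable_minr.
pose m n := fine (\int[mu]_x (g n x)%:E)%E.
have mE n : (\int[mu]_x (g n x)%:E = (m n)%:E)%E.
  rewrite /m fineK// ge0_fin_numE; last by apply: integral_ge0 => x _; rewrite lee_fin.
  apply: le_lt_trans Zoo; apply: ge0_le_integral => //.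
  - by move=> x _; rewrite lee_fin.
  - by apply/measurable_EFinP.
  - by apply/measurable_EFinP.
  - by move=> x _; rewrite lee_fin.
pose q n x := g n x ^+ 2 / (k n)%:R.
have q0 n x : 0 <= q n x by rewrite divr_ge0 ?sqr_ge0// ltW.
have mq n : measurable_fun setT (q n) by apply: measurable_funM => //; apply: measurable_funX.
have qsum : (\sum_(0 <= n <oo) \int[mu]_x (q n x)%:E < +oo)%E.
  rewrite -integral_nneseries//; last 2 first.
  - by move=> n; apply/measurable_EFinP.
  - by move=> n x _; rewrite lee_fin.
  apply: (@le_lt_trans _ _ (\int[mu]_x (4%:E * (Z x)%:E))%E); last first.
    rewrite ge0_integralZl//; [|by apply/measurable_EFinP|by move=> x _; rewrite lee_fin].
    by rewrite lte_mul_pinfty.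
  apply: ge0_le_integral => //.
  - by move=> x _; apply: nneseries_ge0 => n _ _; rewrite lee_fin.
  - apply: ge0_emeasurable_sum => [n x _ _|n _]; first by rewrite lee_fin.
    by apply/measurable_EFinP.
  - by apply: emeasurable_funM => //; apply/measurable_EFinP.
  move=> x _; apply: lime_le.
    by apply: is_cvg_nneseries => n _ _; rewrite lee_fin.
  apply: nearW => n; rewrite sumEFin -EFinM lee_fin big_mkord.
  exact: sum_truncated_sqr.
pose V n w := ((\sum_(j < k n) g n (X j w)) / (k n)%:R - m n) ^+ 2.
pose U n w : R := \sum_(j < k n) \1_[set x | (k n)%:R < Z x] (X j w).
have mS n : measurable [set x | (k n)%:R < Z x].
  have := measurable_fun_ltr (measurable_cst ((k n)%:R : R)) mZ.
  by move=> /(_ measurableT [set true] I); rewrite setTI.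
have V0 n w : 0 <= V n w by exact: sqr_ge0.
have U0 n w : 0 <= U n w by apply: sumr_ge0 => j _; rewrite indicE.
have mX n j : measurable_fun setT (fun w => g n (X j w)) by exact: measurableT_comp.
have mV n : measurable_fun setT (V n).
  apply: measurable_funX; apply: measurable_funB => //; apply: measurable_funM => //.
  exact: measurable_sum.
have mI n j : measurable_fun setT (fun w => \1_[set x | (k n)%:R < Z x] (X j w) : R).
  by apply: measurableT_comp => //; exact: measurable_indic.
have mU n : measurable_fun setT (U n) by exact: measurable_sum.
have iV n : (\int[P]_w (V n w)%:E <= \int[mu]_x (q n x)%:E)%E.
  apply: le_trans (variance_mean (k0 n) (mg n) (g0 n) (mE n)) _.
  rewrite -ge0_integralZl//.
  - by rewrite le_eqVlt; apply/orP; left; apply/eqP; apply: eq_integral => x _; rewrite -EFinM mulrC.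
  - by apply/measurable_EFinP; apply: measurable_funX.
  - by move=> x _; rewrite lee_fin sqr_ge0.
(* Where Z exceeds [k n], the function [q n] equals [k n]. *)
have iU n : (\int[P]_w (U n w)%:E <= \int[mu]_x (q n x)%:E)%E.
  under eq_integral do rewrite /U -sumEFin.
  rewrite ge0_integral_sum//; last by move=> j; apply/measurable_EFinP.
  rewrite (eq_bigr (fun=> \int[mu]_x (\1_[set x | (k n)%:R < Z x] x : R)%:E)%E); last first.
    move=> j _; apply: (@iid_integral j (fun x => (\1_[set x | (k n)%:R < Z x] x : R)%:E)).
      by apply/measurable_EFinP; exact: measurable_indic.
    by move=> x; rewrite lee_fin indicE.
  rewrite sumr_const card_ord -[leLHS]mule_natl -ge0_integralZl//; last first.
    by apply/measurable_EFinP; exact: measurable_indic.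
  apply: ge0_le_integral => //.
  - by apply: emeasurable_funM => //; apply/measurable_EFinP; exact: measurable_indic.
  - exact/measurable_EFinP.
  move=> x _; rewrite -EFinM lee_fin indicE.
  have [|xk] := boolP (x \in _); last by rewrite mulr0.
  rewrite inE/= mulr1 /q /g => kz; rewrite (min_idPr (ltW kz)) expr2 mulfK// gt_eqF//.
have ae0 (Y : nat -> Omega -> R) : (forall n w, 0 <= Y n w) ->
    (forall n, measurable_fun setT (Y n)) ->
    (forall n, \int[P]_w (Y n w)%:E <= \int[mu]_x (q n x)%:E)%E ->
    {ae P, forall w, Y n w @[n --> \oo] --> (0 : R)}.
  move=> Y0 mY iY; apply: ae_nneseries_cvg0 => //; apply: le_lt_trans qsum.
  apply: lee_nneseries => [n _ _|n _]; last exact: iY.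
  by apply: integral_ge0 => w _; rewrite lee_fin.
have aeV := ae0 V V0 mV iV; have aeU := ae0 U U0 mU iU.
have mcvg : m n @[n --> \oo] --> fine (\int[mu]_x (Z x)%:E)%E.
  apply: fine_cvg; rewrite fineK; last first.
    by rewrite ge0_fin_numE//; apply: integral_ge0 => x _; rewrite lee_fin.
  apply: (@dominated_cvg _ _ _ _ _ _ _ _ (fun x => (Z x)%:E)) => //.
  - by move=> n; apply/measurable_EFinP.
  - move=> x _; apply: cvg_near_cst; exists (Num.truncn (Z x)).+1 => // n /= nx.
    rewrite /g; congr EFin; apply/min_idPl; apply: le_trans (ltW (truncnS_gt _)) _.
    rewrite ler_nat (leq_trans nx)// /k (leq_trans (ltnW (ltn_expl n (isT : (1 < 2)%N))))//.
    by rewrite leq_pmull.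
  - apply/integrableP; split; first exact/measurable_EFinP.
    by under eq_integral do rewrite gee0_abs ?lee_fin//.
  - by move=> n x _; rewrite gee0_abs lee_fin.
apply: filterS2 aeV aeU => w Vw Uw.
pose D n := (\sum_(j < k n) g n (X j w)) / (k n)%:R - m n.
have Dw : D n @[n --> \oo] --> (0 : R).
  apply/cvgr0Pnorm_lt => e e0; have e2 : 0 < e ^+ 2 by rewrite exprn_gt0.
  have /cvgr0Pnorm_lt /(_ _ e2) := Vw; apply: filterS => n.
  change (`|D n ^+ 2| < e ^+ 2 -> `|D n| < e).
  by rewrite normrX ltr_pXn2r ?nnegrE ?normr_ge0 ?(ltW e0).
have : D n + m n @[n --> \oo] --> 0 + fine (\int[mu]_x (Z x)%:E)%E by exact: cvgD.
rewrite add0r; apply: cvg_trans; apply: near_eq_cvg.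
(* [U n w] is a count: below 1 it says that no sample of the block is cut. *)
have /cvgr0Pnorm_lt /(_ _ ltr01) := Uw; apply: filterS => n.
rewrite ger0_norm// /D subrK => Un1; congr (_ / _); apply: eq_bigr => j _.
apply/min_idPl; rewrite leNgt; apply/negP => kZ; move: Un1; rewrite ltNge => /negP; apply.
rewrite /U (bigD1 j)//= indicE mem_set//= lerDl.
by apply: sumr_ge0 => i _; rewrite indicE.
Qed.

(** Partial sums of nonnegative terms are monotone, as the interpolation requires. *)
Lemma slln_ge0 (Z : T0 -> R) : measurable_fun setT Z ->
  (forall x, 0 <= Z x) -> (\int[mu]_x (Z x)%:E < +oo)%E ->
  {ae P, forall w, (\sum_(j < n) Z (X j w)) / n%:R @[n --> \oo]
    --> fine (\int[mu]_x (Z x)%:E)%E}.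
Proof.
move=> mZ Z0 Zoo.
have : {ae P, forall w, forall p, (\sum_(j < p.+1 * 2 ^ n) Z (X j w)) / (p.+1 * 2 ^ n)%:R
    @[n --> \oo] --> fine (\int[mu]_x (Z x)%:E)%E}.
  by apply: ae_foralln => p; exact: slln_dyadic.
apply: filterS => w wp.
apply: (@cvg_dyadic_interpolation _ (fun n => \sum_(j < n) Z (X j w))).
- move=> i j ij; rewrite -(subnKC ij) big_split_ord/= lerDl.
  by apply: sumr_ge0 => l _.
- by rewrite fine_ge0// integral_ge0// => x _; rewrite lee_fin.
- by case=> // p _; exact: wp.
Qed.

Lemma slln (f : T0 -> \bar R) : mu.-integrable setT f ->
  {ae P, forall w, (forall j, f (X j w) \is a fin_num) /\
    (n.+1%:R^-1 * \sum_(j < n.+1) fine (f (X j w)) @[n --> \oo]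
       --> fine (\int[mu]_x f x)%E)}.
Proof.
move=> fi; have mf := measurable_int _ fi.
have fin0 := integrable_ae measurableT fi.
have fin : {ae P, forall w, forall j, f (X j w) \is a fin_num}.
  apply: ae_foralln => j.
  by apply: (@iid_ae j (fun x => f x \is a fin_num)); apply: filterS fin0 => x; apply.
have part (h : T0 -> \bar R) : mu.-integrable setT h -> (forall x, 0 <= h x)%E ->
    {ae P, forall w, (\sum_(j < n) fine (h (X j w))) / n%:R @[n --> \oo]
    --> fine (\int[mu]_x h x)%E}.
  move=> hi h0; have mh := measurable_int _ hi.
  have hE : (\int[mu]_x (fine (h x))%:E = \int[mu]_x h x)%E.
    apply: ae_eq_integral => //.
      by apply/measurable_EFinP; exact: measurableT_comp.
    by apply: filterS (integrable_ae measurableT hi) => x /(_ I) hx _; rewrite fineK.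
  rewrite -hE; apply: slln_ge0.
  - exact: measurableT_comp.
  - by move=> x; rewrite fine_ge0.
  - rewrite hE; have /integrableP[_] := hi; apply: le_lt_trans.
    by apply: ge0_le_integral => //; [exact: measurableT_comp|move=> x _; exact: lee_abs].
have := part _ (integrable_funepos measurableT fi) (funepos_ge0 f).
have := part _ (integrable_funeneg measurableT fi) (funeneg_ge0 f).
apply: filterS3 fin => w fw fnw fpw; split => //.
have cv := cvgB fpw fnw.
have FF : Filter (\oo : set_system nat) by exact: eventually_filter.
have := cv FF; rewrite -fineB; last 2 first.
- exact: integrable_pos_fin_num.
- exact: integrable_neg_fin_num.
rewrite -integralE -cvg_shiftS; apply: cvg_trans; apply: near_eq_cvg; apply: nearW => n /=.
transitivity ((\sum_(j < n.+1) fine (f^\+ (X j w))%E) / n.+1%:R -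
  (\sum_(j < n.+1) fine (f^\- (X j w))%E) / n.+1%:R) => //.
rewrite -mulrBl mulrC -sumrB; congr (_ * _); apply: eq_bigr => j _.
rewrite -fineB.
- congr fine; exact: (congr1 (fun h => h (X j w)) (esym (funeposneg f))).
- by rewrite funepos.unlock /Order.max; case: ifP.
- by rewrite funeneg.unlock /Order.max; case: ifP => // _; rewrite fin_numN.
Qed.

End law_of_large_numbers.

(** * Infima over balls and empirical means *)

Lemma limn_einf_le {R : realType} (u : nat -> \bar R) (b : \bar R) :
  (forall n, u n <= b)%E -> (limn_einf u <= b)%E.
Proof.
move=> ub; rewrite limn_einf_lim; apply: lime_le; first exact: is_cvg_einfs.
apply: nearW => n; apply: le_trans (ub n).
by apply: ereal_inf_lbound; exists n => /=.
Qed.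

(** * Positive and negative parts of monotone limits *)

Section nondecreasing_parts.
Context {R : realType} (u : nat -> \bar R) (l : \bar R).
Hypothesis u_nd : {homo u : n m / (n <= m)%N >-> (n <= m)%E}.
Hypothesis ul : u n @[n --> \oo] --> l.

Lemma nondecreasing_cvg_sup : l = ereal_sup (range u).
Proof. by apply: (cvg_unique _ ul (ereal_nondecreasing_cvgn u_nd)); exact: ereal_hausdorff. Qed.

Lemma nondecreasing_cvg_max0 : maxe (u n) 0%E @[n --> \oo] --> maxe l 0%E.
Proof.
have nd : {homo (fun n => maxe (u n) 0%E) : n m / (n <= m)%N >-> (n <= m)%E}.
  by move=> n m nm; rewrite ge_max !le_max lexx orbT andbT u_nd.
suff -> : maxe l 0%E = ereal_sup (range (fun n => maxe (u n) 0%E)).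
  exact: ereal_nondecreasing_cvgn.
apply/le_anti/andP; split.
  rewrite ge_max; apply/andP; split.
    rewrite nondecreasing_cvg_sup; apply: ge_ereal_sup => _ [n _ <-].
    apply: le_trans (ereal_sup_ubound _); last by exists n.
    by rewrite le_max lexx.
  apply: le_trans (ereal_sup_ubound _); last by exists 0%N.
  by rewrite le_max lexx orbT.
apply: ge_ereal_sup => _ [n _ <-]; rewrite ge_max !le_max lexx orbT andbT.
by rewrite nondecreasing_cvg_sup ereal_sup_ubound//; exists n.
Qed.

Lemma nondecreasing_cvg_maxN0 : maxe (- u n)%E 0%E @[n --> \oo] --> maxe (- l)%E 0%E.
Proof.
have NE (x : \bar R) : maxe (- x)%E 0%E = (- mine x 0)%E by rewrite oppe_min oppe0.
rewrite NE; under eq_fun do rewrite NE.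
apply: cvgeN.
have nd : {homo (fun n => mine (u n) 0%E) : n m / (n <= m)%N >-> (n <= m)%E}.
  by move=> n m nm; rewrite le_min !ge_min lexx orbT andbT u_nd.
suff -> : mine l 0%E = ereal_sup (range (fun n => mine (u n) 0%E)).
  exact: ereal_nondecreasing_cvgn.
apply/le_anti/andP; split.
  have [[n un]|nu] := pselect (exists n, (0 <= u n)%E).
    apply: (@le_trans _ _ 0%E); first by rewrite ge_min lexx orbT.
    apply: le_trans (ereal_sup_ubound _); last by exists n.
    by rewrite le_min un lexx.
  rewrite ge_min; apply/orP; left.
  rewrite [leLHS]nondecreasing_cvg_sup; apply: ge_ereal_sup => _ [n _ <-].
  apply: le_trans (ereal_sup_ubound _); last by exists n.
  by rewrite le_min lexx/= leNgt; apply/negP => /ltW un; apply: nu; exists n.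
apply: ge_ereal_sup => _ [n _ <-]; rewrite le_min !ge_min lexx orbT andbT.
by rewrite nondecreasing_cvg_sup ereal_sup_ubound//; exists n.
Qed.

End nondecreasing_parts.

Section penalized_mean_theory.
Context {R : realType} {T E : Type} (psi : T -> E -> \bar R) (pen : nat -> E -> R).
Variables (x : nat -> T) (n : nat) (f : E).

Lemma penalized_mean_ge (y : nat -> R) : 0 <= pen n f ->
  (forall j, ((y j)%:E <= psi (x j) f)%E) ->
  ((n.+1%:R^-1 * \sum_(j < n.+1) y j)%:E <= penalized_mean psi pen x n f)%E.
Proof.
move=> pen0 yx; rewrite /penalized_mean EFinM.
apply: (@le_trans _ _ (n.+1%:R^-1%:E * (\sum_(j < n.+1) psi (x j) f)%dE)%E); last first.
  by rewrite leeDl// lee_fin.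
apply: lee_wpmul2l; first by rewrite lee_fin invr_ge0.
rewrite -DualAddTheoryNumDomain.dsumEFin.
by apply: DualAddTheoryRealDomain.lee_dsum => j _.
Qed.

Lemma penalized_mean_fin : (forall j, psi (x j) f \is a fin_num) ->
  penalized_mean psi pen x n f =
  (n.+1%:R^-1 * (\sum_(j < n.+1) fine (psi (x j) f)) + pen n f)%:E.
Proof.
move=> fin; rewrite /penalized_mean EFinD EFinM; congr (_ * _ + _)%E.
rewrite -DualAddTheoryNumDomain.dsumEFin; apply: eq_bigr => j _.
by rewrite fineK.
Qed.

End penalized_mean_theory.

Lemma ae_forall_countable {d} {T : measurableType d} {R : realType}
    (mu : {measure set T -> \bar R}) (I : countType) (Q : I -> T -> Prop) :
  (forall i, {ae mu, forall x, Q i x}) -> {ae mu, forall x, forall i, Q i x}.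
Proof.
move=> aeQ.
have : {ae mu, forall x, forall n, forall i, @unpickle I n = Some i -> Q i x}.
  apply: ae_foralln => n; case: unpickle => [i|].
    by apply: filterS (aeQ i) => x Qx _ [<-].
  by apply: nearW.
by apply: filterS => x Qx i; exact: Qx (pickleK i).
Qed.

Lemma integral_funeneg_lty {d} {T : measurableType d} {R : realType}
    (mu : {measure set T -> \bar R}) (D : set T) (f : T -> \bar R) :
  (-oo < \int[mu]_(x in D) f x -> \int[mu]_(x in D) f^\- x < +oo)%E.
Proof.
rewrite integralE ltey; apply: contraTneq => ->.
by rewrite addeNy ltxx.
Qed.

(** * Infima over balls: measurability, integrability, limits *)

Section locally_inf_integrable_theory.
Context {R : realType} {d0 : measure_display} {T0 : measurableType d0}.
Context {E : pointedType} (F : set E) (delta : E -> E -> R).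
Hypothesis pm : proper_pmetric F delta.
Variable mu : {finite_measure set T0 -> \bar R}.
Hypothesis mu_complete : measure_is_complete mu.
Variable psi : T0 -> E -> \bar R.
Local Notation borelF := (g_sigma_algebraType (pm_open F delta)).
Hypothesis psi_lsc : forall x (u : nat -> E) f, (forall n, F (u n)) -> F f ->
  delta (u n) f @[n --> \oo] --> (0 : R) -> (psi x f <= limn_einf (psi x \o u))%E.
Hypothesis psi_meas : measurable_fun ([set: T0] `*` F : set (T0 * borelF)%type)
  (fun p : (T0 * borelF)%type => psi p.1 p.2).

Definition ball_inf c r x : \bar R :=
  ereal_inf [set psi x g | g in [set g | F g /\ delta c g <= r]].

Lemma measurable_pm_closed_ball c r : F c ->
  measurable ([set g | F g /\ delta c g <= r] : set borelF).
Proof.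
move=> Fc.
have mF : measurable (F : set borelF).
  by apply: sub_sigma_algebra; split => // f _; exists 1.
have mU : measurable ([set g | F g /\ r < delta c g] : set borelF).
  apply: sub_sigma_algebra; split => [g []//|g [Fg rg]].
  exists (delta c g - r) => [|g' Fg' gg']; first by rewrite subr_gt0.
  split => //; have := pm_triangle pm Fc Fg' Fg; rewrite (pm_sym pm Fg' Fg); lra.
rewrite (_ : [set _ | _] = F `\` [set g | F g /\ r < delta c g]); first exact: measurableD.
apply/seteqP; split => [g [Fg cg]|g [Fg ncg]]; split => //.
  by move=> [_]; rewrite ltNge cg.
by rewrite leNgt; apply/negP => rg; apply: ncg.
Qed.

(** The strict sublevel set at a is exactly a projection: [ball_inf] is below a if and only if some
    g of the ball has psi below a, whether or not the infimum is attained. *)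
Lemma measurable_ball_inf c r : F c -> measurable_fun setT (ball_inf c r).
Proof.
move=> Fc; apply: (measurability _ (ErealGenInftyO.measurableE R)) => //.
move=> _ [_ [a ->] <-].
pose A : set (T0 * borelF) := (setT `*` F) `&` ([set p | (psi p.1 p.2 < a%:E)%E] `&`
  setT `*` [set g | F g /\ delta c g <= r]).
have mF : measurable (F : set borelF).
  by apply: sub_sigma_algebra; split => // f _; exists 1.
have mA : measurable A.
  rewrite /A setIA; apply: measurableI; last first.
    by apply: measurableX => //; exact: measurable_pm_closed_ball.
  by apply: emeasurable_fun_infty_o => //; exact: measurableX.
have := measurable_projection pm mu_complete mA; congr (measurable _).
apply/seteqP; split => [_ [[x g] [[_ [/= pa [_ [Fg cg]]]] _] <-]|x [_ /=]].
  split => //=; rewrite in_itv/=; apply: le_lt_trans pa.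
  by apply: ereal_inf_lbound; exists g.
rewrite in_itv/= => /ereal_inf_lt[_ [g [Fg cg] <-] pa].
by exists (x, g).
Qed.

Lemma measurable_section f : F f -> measurable_fun setT (psi^~ f).
Proof.
move=> Ff; have mF : measurable (F : set borelF).
  by apply: sub_sigma_algebra; split => // g _; exists 1.
pose i (x : T0) : (T0 * borelF)%type := (x, f).
have mi : measurable_fun setT i by apply: measurable_fun_pair => //; exact: measurable_cst.
have iF : i @` setT `<=` setT `*` F by move=> _ [x _ <-].
exact: (measurable_comp (measurableX measurableT mF) iF psi_meas mi).
Qed.

Definition inf_integrable_ball c r : Prop := (\int[mu]_x (ball_inf c r)^\- x < +oo)%E.

Lemma ball_inf_le c r g x : F g -> delta c g <= r -> (ball_inf c r x <= psi x g)%E.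
Proof. by move=> Fg cg; apply: ereal_inf_lbound; exists g. Qed.

Lemma ball_inf_sub c r c' r' x : (forall g, F g -> delta c' g <= r' -> delta c g <= r) ->
  (ball_inf c r x <= ball_inf c' r' x)%E.
Proof.
move=> sub; apply: le_ereal_inf => _ [g [Fg cg] <-].
by exists g => //; split => //; exact: sub.
Qed.

Lemma integral_funeneg_le (f g : T0 -> \bar R) : measurable_fun setT f ->
  measurable_fun setT g -> (forall x, f x <= g x)%E ->
  (\int[mu]_x g^\- x <= \int[mu]_x f^\- x)%E.
Proof.
move=> mf mg fg; apply: ge0_le_integral => //.
- exact: measurable_funeneg.
- exact: measurable_funeneg.
- by move=> x _; apply: (@funeneg_le _ _ setT) => //; rewrite in_setT.
Qed.

Lemma inf_integrable_ball_sub c r c' r' : F c -> F c' ->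
  (forall g, F g -> delta c' g <= r' -> delta c g <= r) ->
  inf_integrable_ball c r -> inf_integrable_ball c' r'.
Proof.
move=> Fc Fc' sub; apply: le_lt_trans; apply: integral_funeneg_le.
- exact: measurable_ball_inf.
- exact: measurable_ball_inf.
- by move=> x; exact: ball_inf_sub.
Qed.

Definition trunc_inf c r (M : nat) x : \bar R := mine (ball_inf c r x) M%:R%:E.

Lemma measurable_trunc_inf c r M : F c -> measurable_fun setT (trunc_inf c r M).
Proof.
by move=> Fc; apply: measurable_mine => //; exact: measurable_ball_inf.
Qed.

Lemma integrable_trunc_inf c r M : F c -> inf_integrable_ball c r ->
  mu.-integrable setT (trunc_inf c r M).
Proof.
move=> Fc good; apply/integrableP; split; first exact: measurable_trunc_inf.
apply: (@le_lt_trans _ _ (\int[mu]_x ((ball_inf c r)^\- x + M%:R%:E))%E).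
  apply: ge0_le_integral => //.
  - by apply: measurableT_comp => //; exact: measurable_trunc_inf.
  - apply: emeasurable_funD => //; apply: measurable_funeneg; exact: measurable_ball_inf.
  - move=> x _; rewrite funenegE /trunc_inf; case: (ball_inf c r x) => [s| |].
    + rewrite -EFin_min abse_EFin -EFinN -EFin_max -EFinD lee_fin ler_norml.
      have M0 : 0 <= M%:R :> R by [].
      by case: (leP s M%:R); case: (leP (- s) 0); move=> ? ?; apply/andP; split; lra.
    + by rewrite (min_idPr (leey _)) abse_EFin ger0_norm// leeDr// le_max lexx orbT.
    + by rewrite (min_idPl (leNye _)) /= (max_idPl (leey _)) addye// leey.
rewrite ge0_integralD//; last exact: measurable_funeneg (measurable_ball_inf _ Fc).
by rewrite lte_add_pinfty// integral_cst// lte_mul_pinfty// ltey_eq fin_num_measure.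
Qed.

Section trunc_limit.
Variables (g : E) (r0 : R).
Hypotheses (Fg : F g) (r0_gt0 : 0 < r0) (good : inf_integrable_ball g r0).
(** One index shrinks the radius and raises the cap, which makes s nondecreasing in m. *)
Let s m x := trunc_inf g (r0 / m.+1%:R) m x.

Let rm0 m : 0 < r0 / m.+1%:R. Proof. by rewrite divr_gt0. Qed.

Let rmle m n : (m <= n)%N -> r0 / n.+1%:R <= r0 / m.+1%:R.
Proof. by move=> mn; rewrite ler_pM2l// lef_pV2 ?posrE// ler_nat. Qed.

Lemma trunc_inf_nondecreasing x : {homo s^~ x : m n / (m <= n)%N >-> (m <= n)%E}.
Proof.
move=> m n mn; rewrite /s /trunc_inf le_min !ge_min lee_fin ler_nat mn orbT andbT.
by rewrite ball_inf_sub// => h _ /le_trans; apply; exact: rmle.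
Qed.

(** If the supremum were below some b < psi x g, the shrinking balls would contain points tending to
    g with psi below b, against lower semicontinuity. *)
Lemma trunc_inf_cvg x : s m x @[m --> \oo] --> psi x g.
Proof.
suff -> : psi x g = ereal_sup (range (s^~ x)).
  by apply: ereal_nondecreasing_cvgn; exact: trunc_inf_nondecreasing.
apply/le_anti/andP; split; last first.
  apply: ge_ereal_sup => _ [m _ <-]; rewrite /s /trunc_inf ge_min ball_inf_le//.
  by rewrite (pm_refl pm Fg) ltW.
rewrite leNgt; apply/negP => /ereal_between[b /andP[sb bg]].
have sm m : (s m x < b%:E)%E.
  by apply: le_lt_trans sb; apply: ereal_sup_ubound; exists m.
(* From index M > b on, it is the infimum and not the cap that lies below b. *)
pose M := (Num.truncn b).+1.
have ex m : exists f, [/\ F f, delta g f <= r0 / (m + M).+1%:R & (psi x f < b%:E)%E].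
  have := sm (m + M)%N; rewrite /s /trunc_inf gt_min => /orP[|].
    by move=> /ereal_inf_lt[_ [f [Ff gf] <-] fb]; exists f.
  rewrite lte_fin => Mb; exfalso; move: Mb; apply/negP; rewrite -leNgt.
  by apply: le_trans (ltW (truncnS_gt b)) _; rewrite ler_nat leq_addl.
have [u uP] := choice ex.
have Fu m : F (u m) by have [] := uP m.
have ug : delta (u m) g @[m --> \oo] --> (0 : R).
  apply/cvgr0Pnorm_lt => e e0; exists (Num.truncn (r0 / e)) => // m /= em.
  rewrite ger0_norm ?(pm_ge0 pm)// (pm_sym pm (Fu m) Fg).
  have [_ gu _] := uP m; apply: le_lt_trans gu _.
  rewrite ltr_pdivrMr// mulrC -ltr_pdivrMr//.
  apply: lt_le_trans (truncnS_gt _) _; rewrite ler_nat ltnS.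
  by rewrite (leq_trans em)// leq_addr.
have := psi_lsc x Fu Fg ug; apply/negP; rewrite -ltNge; apply: le_lt_trans bg.
by apply: limn_einf_le => m /=; have [_ _ /ltW] := uP m.
Qed.

(** Positive parts converge monotonically; negative parts are dominated by that of the infimum over
    the ball of radius r0. Their limit is finite, so the difference converges even when it tends to
    +oo. *)
Lemma integral_trunc_inf_cvg :
  (\int[mu]_x s m x @[m --> \oo] --> \int[mu]_x psi x g)%E.
Proof.
have ms m : measurable_fun setT (s m) by exact: measurable_trunc_inf.
have mg : measurable_fun setT (psi^~ g) by exact: measurable_section.
have h0 : mu.-integrable setT (ball_inf g r0)^\-%E.
  apply/integrableP; split; first by apply: measurable_funeneg; exact: measurable_ball_inf.
  by under eq_integral do rewrite gee0_abs//.
have sneg m x : ((s m)^\- x <= (ball_inf g r0)^\- x)%E.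
  rewrite !funenegE ge_max !le_max lexx orbT andbT leeNl oppeK.
  have sub : (ball_inf g r0 x <= ball_inf g (r0 / m.+1%:R)%R x)%E.
    apply: ball_inf_sub => h _ /le_trans; apply.
    by have := rmle (leq0n m); rewrite divr1.
  have M0 : (0 <= m%:R%:E :> \bar R)%E by rewrite lee_fin.
  case: (leP (ball_inf g r0 x) 0%E) => h; apply/orP; [left|right].
    by rewrite le_min sub (le_trans h M0).
  by rewrite leeNl oppe0 le_min M0 andbT (le_trans (ltW h)).
have ipos : (\int[mu]_x (s m)^\+ x @[m --> \oo] --> \int[mu]_x (psi^~ g)^\+ x)%E.
  rewrite (_ : (\int[mu]_x (psi^~ g)^\+ x = \int[mu]_x limn (fun m => (s m)^\+ x))%E).
    apply: cvg_monotone_convergence => //.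
    - by move=> m; exact: measurable_funepos.
    - move=> x _ m n mn; rewrite !funeposE ge_max !le_max lexx orbT andbT.
      by rewrite trunc_inf_nondecreasing.
  apply: eq_integral => x _; apply/esym/cvg_lim => //.
  rewrite funeposE; under eq_fun do rewrite funeposE.
  exact: nondecreasing_cvg_max0 (@trunc_inf_nondecreasing x) (@trunc_inf_cvg x).
have negcv : {ae mu, forall x, setT x -> (s m)^\-%E x @[m --> \oo] --> (psi^~ g)^\-%E x}.
  apply: aeW => x _; rewrite funenegE; under eq_fun do rewrite funenegE.
  exact: nondecreasing_cvg_maxN0 (@trunc_inf_nondecreasing x) (@trunc_inf_cvg x).
have negdom : {ae mu, forall x, forall m, setT x -> (`|(s m)^\- x| <= (ball_inf g r0)^\- x)%E}.
  by apply: aeW => x m _; rewrite gee0_abs.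
have [ineg0 _ ineg] := dominated_convergence measurableT
  (fun m => measurable_funeneg (ms m)) (measurable_funeneg mg) negcv h0 negdom.
have {}ineg0 : (\int[mu]_x (psi^~ g)^\- x)%E \is a fin_num by exact: integrable_fin_num.
rewrite [X in _ --> X]integralE; under eq_fun do rewrite integralE.
apply: cvgeB ipos ineg.
by rewrite fin_num_adde_defl// fin_numN.
Qed.

End trunc_limit.
End locally_inf_integrable_theory.

Lemma integrable_parts {d} {T : measurableType d} {R : realType}
    (mu : {measure set T -> \bar R}) (f : T -> \bar R) : measurable_fun setT f ->
  (\int[mu]_x f^\+ x < +oo)%E -> (\int[mu]_x f^\- x < +oo)%E -> mu.-integrable setT f.
Proof.
move=> mf fp fn; apply/integrableP; split => //.
have mp := measurable_funepos mf; have mn := measurable_funeneg mf.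
rewrite (eq_integral (fun x => f^\+ x + f^\- x)%E); last first.
  by move=> x _; rewrite -/((abse \o f) x) fune_abse.
by rewrite ge0_integralD// lte_add_pinfty.
Qed.

(** * Almost sure epi-convergence of the penalized means *)

Section empirical_means.
Context {R : realType} {dO : measure_display} {Omega : measurableType dO}.
Variable P : probability Omega R.
Context {d0 : measure_display} {T0 : measurableType d0}.
Variable X : nat -> {mfun Omega >-> T0}.
Hypothesis X_iid : iid P X.
Local Notation mu := (distribution P (X 0%N)).
Hypothesis mu_complete : measure_is_complete mu.
Context {E : pointedType} (F : set E) (delta : E -> E -> R).
Hypothesis pm : proper_pmetric F delta.
Variable psi : T0 -> E -> \bar R.
Local Notation borelF := (g_sigma_algebraType (pm_open F delta)).
Hypothesis psi_lsc : forall x (u : nat -> E) f, (forall n, F (u n)) -> F f ->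
  delta (u n) f @[n --> \oo] --> (0 : R) -> (psi x f <= limn_einf (psi x \o u))%E.
Hypothesis psi_meas : measurable_fun ([set: T0] `*` F : set (T0 * borelF)%type)
  (fun p : (T0 * borelF)%type => psi p.1 p.2).
Hypothesis psi_inf : forall f, F f -> exists2 r : R, 0 < r &
  (-oo < \int[mu]_x ball_inf F delta psi f r x)%E.
Variable pen : nat -> E -> R.
Hypothesis pen_ge0 : forall n f, F f -> 0 <= pen n f.
Hypothesis pen_cvg0 : forall f, F f -> pen n f @[n --> \oo] --> (0 : R).

Local Notation good c r := (inf_integrable_ball F delta mu psi c r).
Local Notation trunc c r M := (trunc_inf F delta psi c r M).

Definition objective (f : E) : \bar R := expect P (fun v => psi (X 0%N v) f).

Lemma exists_good_ball f : F f -> exists2 r : R, 0 < r & good f r.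
Proof.
by move=> /psi_inf[r r0 ri]; exists r => //; exact: integral_funeneg_lty.
Qed.

Lemma section_funeneg_lty f : F f -> (\int[mu]_x (psi^~ f)^\- x < +oo)%E.
Proof.
move=> Ff; have [r r0 rgood] := exists_good_ball Ff; apply: le_lt_trans rgood.
apply: integral_funeneg_le => [||x].
- exact: (measurable_ball_inf pm mu_complete psi_meas).
- exact: measurable_section psi_meas _ Ff.
- by apply: ball_inf_le => //; rewrite (pm_refl pm Ff) ltW.
Qed.

Lemma section_funeneg_fin f : F f -> (\int[mu]_x (psi^~ f)^\- x)%E \is a fin_num.
Proof.
move=> Ff; rewrite ge0_fin_numE; first exact: section_funeneg_lty.
by apply: integral_ge0.
Qed.

(** The two conventions for oo - oo differ only when both parts are infinite, and the negative part
    has a finite integral. *)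
Lemma objective_integral f : F f -> objective f = (\int[mu]_x psi x f)%E.
Proof.
move=> Ff; have mf := measurable_section psi_meas Ff.
rewrite /objective /expect [RHS]integralE.
rewrite (ge0_integral_distribution (X 0%N) (measurable_funepos mf))//.
have neg := section_funeneg_fin Ff.
rewrite (ge0_integral_distribution (X 0%N) (measurable_funeneg mf))// in neg *.
have -> : (\int[P]_w (fun v => psi (X 0%N v) f)^\+ w = \int[P]_w ((psi^~ f)^\+ \o X 0%N) w)%E.
  by apply: eq_integral => w _; rewrite /= !funeposE.
have -> : (\int[P]_w (fun v => psi (X 0%N v) f)^\- w = \int[P]_w ((psi^~ f)^\- \o X 0%N) w)%E.
  by apply: eq_integral => w _; rewrite /= !funenegE.
by case: (\int[P]_x ((psi^~ f)^\- \o X 0%N) x)%E neg => // r _; case: (\int[P]_x _)%E.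
Qed.

Lemma objective_gtNy f : F f -> (-oo < objective f)%E.
Proof.
move=> Ff; rewrite objective_integral// integralE.
have := section_funeneg_fin Ff; have : (0 <= \int[mu]_x (psi^~ f)^\+ x)%E by exact: integral_ge0.
by case: (\int[mu]_x (psi^~ f)^\+ x)%E => // [r|] _; case: (\int[mu]_x _)%E => // s _; rewrite ?ltNyr ?ltNyy.
Qed.

Lemma integrable_section f : F f -> (objective f < +oo)%E -> mu.-integrable setT (psi^~ f).
Proof.
move=> Ff fy; apply: integrable_parts; [exact: measurable_section psi_meas _ Ff| |exact: section_funeneg_lty].
move: fy; rewrite objective_integral// (integralE mu setT (psi^~ f)).
have := section_funeneg_fin Ff.
by case: (\int[mu]_x (psi^~ f)^\- x)%E => // r _; case: (\int[mu]_x _)%E => // s _; rewrite ltry.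
Qed.

Let rq (q : nat) : R := q.+1%:R^-1.

(** A ball of the countable family fits between two balls about g if its radius is below r0 / 2 and
    its centre within half that radius of g. *)
Lemma near_dense_ball (D : nat -> E) g (r0 : R) : (forall n, F (D n)) ->
  (forall f (e : R), F f -> 0 < e -> exists n, delta (D n) f < e) -> F g -> 0 < r0 ->
  exists i q (r : R), [/\ 0 < r, forall f, F f -> delta g f < r -> delta (D i) f <= rq q &
    forall f, F f -> delta (D i) f <= rq q -> delta g f <= r0].
Proof.
move=> FD Dd Fg r00.
have [q qr] : exists q, rq q < r0 / 2.
  by exists (Num.truncn (r0 / 2)^-1); rewrite /rq invf_plt ?posrE ?divr_gt0// truncnS_gt.
have q0 : 0 < rq q by rewrite /rq invr_gt0.
have [i ig] := Dd g (rq q / 2) Fg (divr_gt0 q0 (ltr0Sn _ 1)).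
exists i, q, (rq q / 2); split; first by rewrite divr_gt0.
  by move=> f Ff gf; have := pm_triangle pm (FD i) Fg Ff; lra.
by move=> f Ff fi; have := pm_triangle pm Fg (FD i) Ff; rewrite (pm_sym pm Fg (FD i)); lra.
Qed.

Lemma ae_epi_convergence c : F c ->
  {ae P, forall w, [/\
    liminf_below F delta (penalized_mean psi pen (fun j => X j w)) objective,
    limsup_above F delta (penalized_mean psi pen (fun j => X j w)) objective &
    locally_bounded_below F delta (penalized_mean psi pen (fun j => X j w))]}.
Proof.
move=> Fc; have [D FD Dd] := pm_separable pm Fc.
have ev1 : {ae P, forall w, forall p : nat * nat * nat, good (D p.1.1) (rq p.1.2) ->
    (forall j, trunc (D p.1.1) (rq p.1.2) p.2 (X j w) \is a fin_num) /\
    (n.+1%:R^-1 * \sum_(j < n.+1) fine (trunc (D p.1.1) (rq p.1.2) p.2 (X j w))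
      @[n --> \oo] --> fine (\int[mu]_x trunc (D p.1.1) (rq p.1.2) p.2 x)%E)}.
  apply: ae_forall_countable => p.
  have [g|ng] := pselect (good (D p.1.1) (rq p.1.2)); last by apply: aeW => w /ng.
  have := slln X_iid (integrable_trunc_inf pm mu_complete psi_meas p.2 (FD _) g).
  by apply: filterS => w.
(* J is not continuous and may be too large at the dense points themselves, so one point is selected
   for each small ball and each rational level that J undercuts there. *)
pose cand (p : nat * nat * rat) h := [/\ F h, delta (D p.1.1) h < rq p.1.2 &
  (objective h < (ratr p.2)%:E)%E].
have selex p : exists h, (exists h, cand p h) -> cand p h.
  have [[h hp]|nh] := pselect (exists h, cand p h); first by exists h.
  by exists c.
have [sel selP] := choice selex.
have ev2 : {ae P, forall w, forall p, cand p (sel p) ->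
    (forall j, psi (X j w) (sel p) \is a fin_num) /\
    (n.+1%:R^-1 * \sum_(j < n.+1) fine (psi (X j w) (sel p))
      @[n --> \oo] --> fine (\int[mu]_x psi x (sel p))%E)}.
  apply: ae_forall_countable => p.
  have [[Fh _ Jh]|ng] := pselect (cand p (sel p)); last by apply: aeW => w /ng.
  have := slln X_iid (integrable_section Fh (lt_le_trans Jh (leey _))).
  by apply: filterS => w.
apply: filterS2 ev1 ev2 => w w1 w2; split.
- move=> g a Fg; rewrite objective_integral// => aJ.
  have [r0 r00 good0] := exists_good_ball Fg.
  have cv := integral_trunc_inf_cvg pm mu_complete psi_lsc psi_meas Fg r00 good0.
  have [m am] : exists m, (a%:E < \int[mu]_x trunc g (r0 / m.+1%:R)%R m x)%E.
    apply: contrapT => nm; move: aJ; apply/negP; rewrite -leNgt -(cvg_lim _ cv)//.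
    apply: lime_le; first by apply/cvg_ex; eexists; exact: cv.
    by apply: nearW => m; rewrite leNgt; apply/negP => am; apply: nm; exists m.
  have rm0 : 0 < r0 / m.+1%:R by rewrite divr_gt0.
  have [i [q [r [r_gt0 rD Dr]]]] := near_dense_ball FD Dd Fg rm0.
  have goodm : good g (r0 / m.+1%:R).
    apply: (inf_integrable_ball_sub pm mu_complete psi_meas Fg Fg _ good0) => f _ /le_trans; apply.
    by rewrite ler_pdivrMr// ler_peMr ?ler1n// ltW.
  have goodi : good (D i) (rq q).
    exact: (inf_integrable_ball_sub pm mu_complete psi_meas Fg (FD i) Dr goodm).
  have inti := integrable_trunc_inf pm mu_complete psi_meas m (FD i) goodi.
  have [fin mean] := w1 (i, q, m) goodi; rewrite /= in fin mean.
  have ai : (a%:E < \int[mu]_x trunc (D i) (rq q) m x)%E.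
    apply: lt_le_trans am _; apply: le_integral => //.
      exact: (integrable_trunc_inf pm mu_complete psi_meas m Fg goodm).
    move=> x _; rewrite /trunc_inf le_min !ge_min lexx orbT andbT.
    by rewrite (ball_inf_sub psi x Dr).
  rewrite -[ltRHS]fineK ?lte_fin in ai; last exact: integrable_fin_num.
  have [n0 _ n0P] := cvgr_gt _ mean _ ai.
  exists r => //; exists n0 => n f nn Ff gf.
  apply: (le_trans _ (@penalized_mean_ge _ _ _ psi pen (fun j => X j w) n f
    (fun j => fine (trunc (D i) (rq q) m (X j w))) (pen_ge0 n Ff) _)).
    by rewrite lee_fin ltW//; exact: n0P.
  move=> j; rewrite fineK// /trunc_inf ge_min; apply/orP; left.
  by apply: ball_inf_le => //; exact: rD.
- move=> g b e Fg Jb e0.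
  have [x Jx] : exists x, objective g = x%:E.
    have := objective_gtNy Fg; have := lt_le_trans Jb (leey _).
    by case: (objective g) => // x _ _; exists x.
  move: (Jb); rewrite Jx lte_fin => /rat_in_itvoo[b']; rewrite in_itv/= => /andP[xb' b'b].
  have [q qe] : exists q, rq q < e / 2.
    by exists (Num.truncn (e / 2)^-1); rewrite /rq invf_plt ?posrE ?divr_gt0// truncnS_gt.
  have q0 : 0 < rq q by rewrite /rq invr_gt0.
  have [i ig] := Dd g (rq q) Fg q0.
  have ch : cand (i, q, b') (sel (i, q, b')).
    by apply: selP; exists g; split => //=; rewrite Jx lte_fin.
  have [fin mean] := w2 _ ch.
  move: (ch) fin mean; set h := sel _ => -[/= Fh ih Jh] fin mean.
  exists h; split => //.
    have := pm_triangle pm Fh (FD i) Fg; rewrite (pm_sym pm Fh (FD i)); lra.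
  have Jh' : fine (\int[mu]_x psi x h)%E < ratr b'.
    rewrite -lte_fin fineK -?objective_integral//.
    have := objective_gtNy Fh; have := lt_le_trans Jh (leey _).
    by case: (objective h).
  have [n0 _ n0P] := cvgr_lt _ mean _ Jh'.
  have bb' : 0 < b - ratr b' by rewrite subr_gt0.
  have [n1 _ n1P] := cvgr_lt _ (pen_cvg0 Fh) _ bb'.
  exists (maxn n0 n1) => n; rewrite geq_max => /andP[nn0 nn1].
  rewrite penalized_mean_fin// lee_fin.
  by rewrite ltW// -(subrKC (ratr b') b) ltrD//; [exact: n0P|exact: n1P].
- move=> n g Fg; have [r0 r00 good0] := exists_good_ball Fg.
  have [i [q [r [r_gt0 rD Dr]]]] := near_dense_ball FD Dd Fg r00.
  have goodi : good (D i) (rq q).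
    exact: (inf_integrable_ball_sub pm mu_complete psi_meas Fg (FD i) Dr good0).
  (* Cap 0 suffices: n is fixed, so finite values at the sample points already give a bound. *)
  have [fin _] := w1 (i, q, 0%N) goodi; rewrite /= in fin.
  exists r => //; exists (n.+1%:R^-1 * \sum_(j < n.+1) fine (trunc (D i) (rq q) 0 (X j w))).
  move=> f Ff gf.
  apply: (@penalized_mean_ge _ _ _ psi pen (fun j => X j w) n f
    (fun j => fine (trunc (D i) (rq q) 0 (X j w))) (pen_ge0 n Ff)) => j.
  rewrite fineK// /trunc_inf ge_min; apply/orP; left.
  by apply: ball_inf_le => //; exact: rD.
Qed.

End empirical_means.

(** * Almost sure consistency of approximate minimizers *)

Unset Implicit Arguments.

Theorem theorem3p10 (R : realType) (d d0 : nat)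
  (S : set 'rV[R]_d) (S_nonempty : S !=set0) (S_closed : closed S)
  (N : 'rV[R]_d * R^o -> R) (N_norm : is_norm N)
  (ctr : 'rV[R]_d * R^o) (ctr_S : S ctr.1)
  (S0 : set 'rV[R]_d0) (x0 : S0)
  (B0 : set (set S0)) (B0_sigma : sigma_algebra [set: S0] B0)
  (B0_borel : forall U : set S0, open U -> B0 U)
  (dO : measure_display) (Omega : measurableType dO) (P : probability Omega R)
  (X : nat -> {mfun Omega >-> sample_space x0 B0}) (X_iid : iid P X)
  (P0_complete : measure_is_complete (distribution P (X 0%N)))
  (F : set (efun S)) (F_closed : aw_closed N ctr F)
  (psi : sample_space x0 B0 -> efun S -> \bar R)
  (psi_lsc : random_lsc N ctr F psi)
  (psi_inf : locally_inf_integrable N ctr F psi (distribution P (X 0%N)))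
  (pen : nat -> efun S -> R)
  (pen_ge0 : forall n f, F f -> 0 <= pen n f)
  (pen_cvg0 : forall (u : nat -> efun S) (f : efun S),
     (forall n, F (u n)) -> uscfcns f -> aw_cvg N ctr u f ->
     pen n (u n) @[n --> \oo] --> (0 : R)) :
  {ae P, forall w,
    (forall eps : nat -> R, (forall n, 0 <= eps n) ->
       eps n @[n --> \oo] --> (0 : R) ->
       outlim N ctr (fun n =>
         eps_argmin (eps n) F (penalized_mean psi pen (fun j => X j w) n))
       `<=` argmin F (fun f => expect P (fun v => psi (X 0%N v) f)))
    /\
    ((exists2 f, F f & (expect P (fun v => psi (X 0%N v) f) < +oo)%E) ->
     aw_bounded N ctr F ->
     exists eps : nat -> R,
       [/\ forall n, 0 <= eps n,
           eps n @[n --> \oo] --> (0 : R) &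
           set_converges N ctr (fun n =>
             eps_argmin (eps n) F (penalized_mean psi pen (fun j => X j w) n))
             (argmin F (fun f => expect P (fun v => psi (X 0%N v) f)))])}.
Proof.
have pm := aw_proper_pmetric N_norm S_closed F_closed.
have [Fusc Fcl] := F_closed.
have F_cluster (a : nat -> efun S) f : uscfcns f -> (forall n, F (a n)) -> aw_cvg N ctr a f -> F f.
  move=> fusc Fa /cvgr0Pnorm_lt af; apply: Fcl => // e e0.
  have [n _ /(_ n (leqnn n)) /= afn] := af e e0.
  exists (a n) => //; rewrite aw_sym; apply: le_lt_trans afn; exact: ler_norm.
(* Constant sequences turn the assumption on [pen] into convergence to 0 at each point of F. *)
have const_cvg f : F f -> aw_cvg N ctr (fun=> f) f.
  by move=> Ff; rewrite /aw_cvg (pm_refl pm Ff); exact: cvg_cst.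
(* Without a point of F there is no centre for the balls, but then both claims are void. *)
have [[c Fc]|nF] := pselect (exists c, F c); last first.
  apply: aeW => w; split.
    move=> eps eps0 epsc f [fusc [k [_ [a [aA _]]]]].
    by have [Fa _] := aA 0%N; case: nF; exists (a 0%N).
  by move=> [f Ff]; case: nF; exists f.
have [psi_lsc1 psi_meas] := psi_lsc.
have := @ae_epi_convergence R dO Omega P _ (sample_space x0 B0) X X_iid P0_complete
  (efun S) F (aw N ctr) pm psi psi_lsc1 psi_meas psi_inf pen pen_ge0
  (fun f Ff => pen_cvg0 (fun=> f) f (fun=> Ff) (Fusc f Ff) (const_cvg f Ff)) c Fc.
have J_gtNy := @objective_gtNy R dO Omega P _ (sample_space x0 B0) X P0_complete
  (efun S) F (aw N ctr) pm psi psi_meas psi_inf.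
apply: filterS => w [LI UL LB].
have outl (eps : nat -> R) : (forall n, 0 <= eps n) -> eps n @[n --> \oo] --> (0 : R) ->
    outlim N ctr (fun n =>
      eps_argmin (eps n) F (penalized_mean psi pen (fun j => X j w) n))
    `<=` argmin F (fun f => expect P (fun v => psi (X 0%N v) f)).
  move=> eps0 epsc f [fusc [k [hk [a [aA af]]]]].
  have Ff : F f by apply: (F_cluster a f fusc _ af) => i; have [] := aA i.
  exact: (argmin_cluster pm LI UL eps0 epsc hk aA Ff af).
split=> // [[f0 Ff0 Jf0] [M FM]].
have [eps [eps0 epsc att]] := argmin_attained pm LI UL LB J_gtNy Ff0
  (fun f Ff => FM f0 f Ff0 Ff) Jf0.
exists eps; split => //.
have inn : argmin F (fun f => expect P (fun v => psi (X 0%N v) f)) `<=`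
    innlim N ctr (fun n => eps_argmin (eps n) F (penalized_mean psi pen (fun j => X j w) n)).
  move=> f fA; split; first by apply: Fusc; case: fA.
  by have [a [aA af]] := att f fA; exists a.
have innout : innlim N ctr (fun n => eps_argmin (eps n) F (penalized_mean psi pen (fun j => X j w) n))
   `<=` outlim N ctr (fun n => eps_argmin (eps n) F (penalized_mean psi pen (fun j => X j w) n)).
  by move=> f [fusc [a [aA af]]]; split => //; exists id; split => //; exists a.
(* The inclusions close up: argmin in [innlim] in [outlim] in argmin. *)
split; apply/seteqP; split.
- exact: outl.
- exact: subset_trans inn innout.
- exact: subset_trans innout (outl eps eps0 epsc).
- exact: inn.
Qed.
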